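(* Consider the linear Gaussian structural equation model with soft interventions described in the context, with node $N$ the reward node, and let $\boldsymbol a\in\{0,1\}^N$ be an intervention. Under the assumption of MMSE estimation of the edge weights and of no false negative errors, the following inequality holds: $$\mathbb P\Bigl\{\bigl|[\Delta\boldsymbol\mu_{\boldsymbol a}^t]_N\bigr|\ge U(\boldsymbol X^{1:t},\boldsymbol a,\delta)\Bigr\}\le\delta,$$ where $U(\boldsymbol X^{1:t},\boldsymbol a,\delta)$ is the error upper bound at confidence level $1-\delta$, $$U(\boldsymbol X^{1:t},\boldsymbol a,\delta)=2\,(N^2+2N)^{1/4}\,\Bigl\lVert\bigl[(\boldsymbol I-\widehat{\boldsymbol B}_{\boldsymbol a}^t)^{-1}\bigr]_N\Bigr\rVert_2\,\lVert\boldsymbol\mu_{\boldsymbol a}\rVert_2\,\sqrt{\ln\Bigl(\frac{2N}{\delta}\Bigr)\sum_{i=1}^N\lambda_{\max}\bigl(\boldsymbol\Phi_{\boldsymbol a}^t(i)\bigr)}.$$ Here $[\,\cdot\,]_N$ denotes the $N$-th entry of a vector and the $N$-th column of a matrix, and $\lambda_{\max}$ is the maximum eigenvalue.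
   Context: Model. The nodes are $\{1,\dots,N\}$. There are an observational weight matrix $\boldsymbol B\in\mathbb R^{N\times N}$ and an interventional weight matrix $\boldsymbol B'\in\mathbb R^{N\times N}$; the $(k,i)$ entry is the weight of the directed edge $k\to i$. For an intervention $\boldsymbol a\in\{0,1\}^N$, the post-intervention matrix $\boldsymbol B_{\boldsymbol a}$ has $i$-th column equal to the $i$-th column of $\boldsymbol B'$ if $a_i=1$ and of $\boldsymbol B$ if $a_i=0$. The causal graphs are directed acyclic graphs. The parent set $\mathcal P_i(a_i)$ of node $i$ is the set of $k$ with an edge $k\to i$ in the graph of $\boldsymbol B_{\boldsymbol a}$. Under intervention $\boldsymbol a$ the vector of node values satisfies $\boldsymbol x=\boldsymbol B_{\boldsymbol a}^\top\boldsymbol x+\boldsymbol\epsilon$, where $\boldsymbol\epsilon$ is a vector of independent Gaussian exogenous variables with known means $\boldsymbol\nu$ and unknown variances $\boldsymbol\sigma^2$. At each step $\tau$ an agent selects an intervention $\boldsymbol a^\tau$ and observes $\boldsymbol x^\tau$ generated by this model; the randomness of the observations comes from the exogenous variables, which are independent of the intervention. Write $\boldsymbol X^{1:t}=(\boldsymbol x^1,\dots,\boldsymbol x^t)\in\mathbb R^{N\times t}$. Estimation. $\widehat{\mathcal P}_i(a_i)$ is the estimated parent set of node $i$ (the nodes declared to be parents of $i$ on the basis of the observed data). For a node set $S$, $\boldsymbol X^{1:t}_S(a_i)$ denotes the observed values of the nodes in $S$ up to step $t$, restricted to the steps at which node $i$ has intervention status $a_i$. With $\boldsymbol Z_i=\boldsymbol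 X^{1:t}_{\widehat{\mathcal P}_i(a_i)}(a_i)$, the MMSE estimate $\widehat{\boldsymbol B}_{\boldsymbol a}^t$ of $\boldsymbol B_{\boldsymbol a}$ has $i$-th column with entries on $\widehat{\mathcal P}_i(a_i)$ given by $(\boldsymbol Z_i\boldsymbol Z_i^\top)^{-1}\boldsymbol Z_i\,(\boldsymbol X_i^{1:t}(a_i)-\nu_i\boldsymbol 1^\top)^\top$, with $\boldsymbol 1$ the all-ones vector, and zero entries elsewhere. Errors. $\Delta\boldsymbol B_{\boldsymbol a}^t=\widehat{\boldsymbol B}_{\boldsymbol a}^t-\boldsymbol B_{\boldsymbol a}$, and $\boldsymbol\Phi_{\boldsymbol a}^t(i)$ is the covariance of its $i$-th column (the $i$-th weight error vector). The expected node values are $\boldsymbol\mu_{\boldsymbol a}=(\boldsymbol I-\boldsymbol B_{\boldsymbol a})^{-\top}\boldsymbol\nu$, their estimates are $\hat{\boldsymbol\mu}_{\boldsymbol a}^t=(\boldsymbol I-\widehat{\boldsymbol B}_{\boldsymbol a}^t)^{-\top}\boldsymbol\nu$, and $\Delta\boldsymbol\mu_{\boldsymbol a}^t=\hat{\boldsymbol\mu}_{\boldsymbol a}^t-\boldsymbol\mu_{\boldsymbol a}$. A false negative error is an edge that is present in the true causal graph (observational or interventional) but absent from the estimated one; no false negative errors means that there is no such edge.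
   Formalization: Φ is the covariance given interventions and regressors (unconditionally false: heavy tails); interventions are independent of all noise; estimated graphs are acyclic (else bias); variances positive, Gram matrices invertible; ν≠0 and some edge estimated (else U=0, event certain). *)

(* Defs.v *)
From HB Require Import structures.
From mathcomp Require Import all_boot all_order all_algebra.
From mathcomp Require Import all_classical all_reals all_analysis.

Set Implicit Arguments.
Unset Strict Implicit.
Unset Printing Implicit Defensive.

Import Order.TTheory GRing.Theory Num.Theory.
Import numFieldNormedType.Exports.

Local Open Scope classical_set_scope.
Local Open Scope ring_scope.

Section Graphs.
Variables (R : realType) (m : nat).

Definition intervention := {ffun 'I_m -> bool}.

Definition post_mx (B B' : 'M[R]_m) (a : intervention) : 'M[R]_m :=
  \matrix_(k, i) (if a i then B' k i else B k i).

Definition parents (M : 'M[R]_m) (i : 'I_m) : {set 'I_m} :=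
  [set k | M k i != 0]%SET.

(* In MathComp's [cycle], [:: x] is a cycle exactly when there is a loop at x,
   so self-loops are excluded as well. *)
Definition acyclic (pa : 'I_m -> {set 'I_m}) : Prop :=
  forall p : seq 'I_m, cycle (fun k i => k \in pa i) p -> p = [::].

Definition norm2 (v : 'cV[R]_m) : R := Num.sqrt (\sum_k v k 0 ^+ 2).

(* On a symmetric matrix of positive size this is the supremum of a finite
   nonempty set, hence the largest eigenvalue. *)
Definition lambda_max (M : 'M[R]_m) : R := sup [set l : R | eigenvalue M l].

Definition mean_mx (M : 'M[R]_m) (nu : 'cV[R]_m) : 'cV[R]_m :=
  (invmx (1%:M - M))^T *m nu.

End Graphs.

Section Estimation.
Variables (R : realType) (m t : nat).

(* The interventions selected at the steps 1, ..., t. *)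
Definition policy := {ffun 'I_t -> intervention m}.

Implicit Types (X : 'M[R]_(m, t)) (A : policy).

Definition steps A (i : 'I_m) (b : bool) : {set 'I_t} :=
  [set s | A s i == b]%SET.

Definition regressors X A (i : 'I_m) (b : bool) (S : {set 'I_m}) :
    'M[R]_(#|S|, #|steps A i b|) :=
  \matrix_(p, q) X (enum_val p) (enum_val q).

Definition response X A (i : 'I_m) (b : bool) : 'rV[R]_#|steps A i b| :=
  \row_q X i (enum_val q).

Definition gram X A (i : 'I_m) (b : bool) (S : {set 'I_m}) : 'M[R]_#|S| :=
  regressors X A i b S *m (regressors X A i b S)^T.

Definition mmse_coef X A (nu : 'cV[R]_m) (i : 'I_m) (b : bool)
    (S : {set 'I_m}) : 'cV[R]_#|S| :=
  invmx (gram X A i b S) *m regressors X A i b S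
    *m (response X A i b - const_mx (nu i 0))^T.

(* Extension by zero outside S: the sum has at most one term. *)
Definition mmse_col X A (nu : 'cV[R]_m) (i : 'I_m) (b : bool)
    (S : {set 'I_m}) : 'cV[R]_m :=
  \col_k \sum_(p < #|S| | enum_val p == k) mmse_coef X A nu i b S p 0.

Definition mmse_mx X A (nu : 'cV[R]_m) (Phat : 'I_m -> bool -> {set 'I_m})
    (a : intervention m) : 'M[R]_m :=
  \matrix_(k, i) mmse_col X A nu i (a i) (Phat i (a i)) k 0.

(* The i-th weight error vector when the declared parent set of i is S. *)
Definition weight_error X A (B B' : 'M[R]_m) (nu : 'cV[R]_m)
    (a : intervention m) (i : 'I_m) (S : {set 'I_m}) : 'cV[R]_m :=
  mmse_col X A nu i (a i) S - col i (post_mx B B' a).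

End Estimation.

Section Probability.
Context {d : measure_display} {T : measurableType d} {R : realType}.
Variable P : probability T R.

(* g is a version of E[f | G].  It is only required that f be integrable on
   each set of some countable cover by G-sets, rather than on T: entries of an
   inverse Gram matrix can have infinite moments although their conditional
   moments given the regressors are finite. *)
Definition cond_expectation (G : set (set T)) (f g : T -> R) : Prop :=
  [/\ forall Q : set R, measurable Q -> G (g @^-1` Q),
      exists F : nat -> set T,
        [/\ forall k, G (F k), \bigcup_k F k = setT &
            forall k, P.-integrable (F k) (EFin \o f)] &
      forall E : set T, G E -> P.-integrable E (EFin \o f) ->
        (\int[P]_(w in E) (f w)%:E = \int[P]_(w in E) (g w)%:E)%E].

(* C is a (symmetric) version of the covariance matrix of v given G. *)
Definition cond_covariance (G : set (set T)) (m : nat)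
    (v : T -> 'cV[R]_m) (C : T -> 'M[R]_m) : Prop :=
  (forall w, (C w)^T = C w) /\
  exists e : T -> 'cV[R]_m,
    (forall k, cond_expectation G (fun w => v w k 0) (fun w => e w k 0)) /\
    (forall k l, cond_expectation G
      (fun w => (v w k 0 - e w k 0) * (v w l 0 - e w l 0))
      (fun w => C w k l)).

Variables (m t : nat).

(* The sigma-algebra generated by the selected interventions and by the
   regressors of node i for the parent set S. *)
Definition design_sigma (X : T -> 'M[R]_(m, t)) (A : T -> policy m t)
    (i : 'I_m) (b : bool) (S : {set 'I_m}) : set (set T) :=
  <<s [set E | (exists c, E = [set w | A w = c]) \/
               (exists k s (Q : set R), [/\ k \in S, measurable Q &
                  E = [set w | A w s i = b /\ Q (X w k s)]])] >>.

Definition independent_noise (eps : 'I_t -> 'I_m -> {RV P >-> R}) : Prop :=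
  forall Q : 'I_t -> 'I_m -> set R, (forall s i, measurable (Q s i)) ->
    P [set w | forall s i, Q s i (eps s i w)]
      = (\prod_(s < t) \prod_(i < m) P [set w | Q s i (eps s i w)])%E.

Definition independent_of_noise (eps : 'I_t -> 'I_m -> {RV P >-> R})
    (A : T -> policy m t) : Prop :=
  forall (c : policy m t) (Q : 'I_t -> 'I_m -> set R),
    (forall s i, measurable (Q s i)) ->
    P [set w | A w = c /\ forall s i, Q s i (eps s i w)]
      = (P [set w | A w = c] * P [set w | forall s i, Q s i (eps s i w)])%E.

End Probability.

(* The bound U for N = n.+1 nodes, the reward node being ord_max;
   Phi i is the covariance of the i-th weight error vector. *)
Definition error_bound (R : realType) (n : nat) (Bhat : 'M[R]_n.+1)
    (mu : 'cV[R]_n.+1) (Phi : 'I_n.+1 -> 'M[R]_n.+1) (delta : R) : R :=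
  2 * (n.+1%:R ^+ 2 + 2 * n.+1%:R) `^ (4^-1)
  * norm2 (col ord_max (invmx (1%:M - Bhat)))
  * norm2 mu
  * Num.sqrt (ln (2 * n.+1%:R / delta) * \sum_i lambda_max (Phi i)).

(* Main.v *)
Require Import Defs.
From mathcomp Require Import all_boot all_order all_algebra.
From mathcomp Require Import all_classical all_reals all_analysis.
From HB Require Import structures.
From mathcomp Require Import measurable_realfun ring lra.

(** The error of the mean is a linear image of the weight errors:
    [Dmu = (I - Bhat)^-T (Bhat - B)^T mu], so by Cauchy-Schwarz its last entry is
    at most the norm of the last column of [(I - Bhat)^-1] times the norm of the
    vector of the inner products of [mu] with the weight error vectors.

    For a fixed parent set [S] that contains the parents of [i] and none of its
    descendants, the exogenous variables of node [i] are independent of the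
    design, i.e. of the interventions and the regressors.  Given the design, the
    least-squares error is therefore a centered Gaussian vector whose covariance
    is [Phi i S], and its inner product with [mu] has variance at most
    [lambda_max (Phi i S) * |mu|^2]; an exponential martingale over the steps
    gives the Gaussian tail bound.

    The estimated parent set depends on the same data, so it cannot be
    conditioned upon.  But together with the absence of false negatives, the
    acyclicity of the estimated graphs forces it to be one of the at most [2^N]
    sets above, and a union bound over the pairs [(i, S)] is affordable: the
    factor [(N^2 + 2N)^(1/4) >= N^(1/2)] of the bound turns the tail probability
    [2 * delta / (2N)] into at most [2 * (delta / (2N))^(2N)]. *)

Set Implicit Arguments.
Unset Strict Implicit.
Unset Printing Implicit Defensive.
Import Order.TTheory GRing.Theory Num.Theory.
Import numFieldNormedType.Exports.

Local Open Scope classical_set_scope.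
Local Open Scope ring_scope.

(** * Acyclic weight matrices and the Rayleigh quotient *)

(** No conditional law is ever built. For each step, the exogenous variable of node [i] is
    independent of a sigma-algebra carrying the interventions and all the other noise, and the
    design lies in it. The exponential estimate and the second moments both rest on this single
    fact.

    [Phi i S] is an arbitrary version of a conditional covariance, known only through integrals over
    design events, and inverse Gram matrices may have infinite moments. It is therefore computed on
    design events where the coefficients are bounded, and uniqueness of conditional expectations
    identifies it almost everywhere with the noise variance times [L L^T], [L] being the matrix of
    noise coefficients. Finitely many pairs [(i, S)] share one null set, which permits evaluation at
    the data-dependent parent set.

    The error event is a closed inequality, so a bound equal to 0 would always be reached.
    Strictness comes from one positive [lambda_max], due to a nonempty declared parent set with an
    invertible Gram matrix, and outcomes of zero variance are kept out of the tail events. *)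

Section AcyclicMatrix.
Variables (R : realType) (m : nat).
Implicit Types (M : 'M[R]_m) (h : 'I_m -> nat).

(** The rank of a node is its number of ancestors, itself included. Ancestors of a parent are
    ancestors of the child, and the child is not among them, since that would close a cycle. *)
Lemma acyclic_rank (pa : 'I_m -> {set 'I_m}) : acyclic pa ->
  exists h : 'I_m -> nat, forall k i, k \in pa i -> (h k < h i)%N.
Proof.
move=> pa_acyclic; pose e : rel 'I_m := fun k i => k \in pa i.
exists (fun i => #|[set j | connect e j i]%SET|) => k i ki.
apply: proper_card; apply/properP; split.
  apply/fintype.subsetP => j; rewrite !inE => jk.
  exact: connect_trans jk (connect1 ki).
exists i; rewrite inE ?connect0//; apply/connectP => -[p ip kE].
suff : i :: p = [::] by [].
by apply: pa_acyclic; rewrite /= rcons_path ip -kE.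
Qed.

(** A left kernel vector satisfies [v = v *m M], so each entry is a combination of entries of
    smaller rank, and induction on the rank kills them all. *)
Lemma one_sub_unitmx M h :
  (forall k i, M k i != 0 -> (h k < h i)%N) -> 1%:M - M \in unitmx.
Proof.
move=> hM; rewrite -row_free_unit -kermx_eq0; apply/rowV0P => v.
move=> /sub_kermxP; rewrite mulmxBr mulmx1 => /subr0_eq vE.
suff H l k : (h k < l)%N -> v 0 k = 0.
  by apply/rowP => k; rewrite mxE (H (h k).+1).
elim: l k => // l IH k; rewrite ltnS => hkl.
rewrite vE mxE big1// => j _; have [->|Mjk] := eqVneq (M j k) 0.
  by rewrite mulr0.
by rewrite IH ?mul0r// (leq_trans (hM _ _ Mjk)).
Qed.

(** The [(i, k)] entry of the inverse sums the weights of the directed paths from [i] to [k], and no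
    path leaves a set closed under children. The path sum is replaced by the recursion
    [W = 1 + W *m M], unfolded along the rank of [k]. *)
Lemma invmx_one_sub_eq0 M h (D : {set 'I_m}) i k :
  (forall k i, M k i != 0 -> (h k < h i)%N) ->
  (forall j l, j \in D -> M j l != 0 -> l \in D) ->
  i \in D -> k \notin D -> invmx (1%:M - M) i k = 0.
Proof.
move=> hM DM iD; have [l] := ubnP (h k); elim: l k => // l IH k.
rewrite ltnS => hkl kD; set W := invmx _.
have WE : W = 1%:M + W *m M.
  have : W *m (1%:M - M) = 1%:M by rewrite mulVmx// (one_sub_unitmx hM).
  by rewrite mulmxBr mulmx1 => /eqP; rewrite subr_eq => /eqP.
rewrite WE !mxE big1 => [|j _].
  by rewrite addr0; case: eqVneq kD => // <-; rewrite iD.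
have [->|Mjk] := eqVneq (M j k) 0; first by rewrite mulr0.
rewrite IH ?mul0r// ?(leq_trans (hM _ _ Mjk))//.
by apply: contra kD => jD; exact: DM Mjk.
Qed.

(** Resolvent identity: [Mhat - M] is the difference of the two matrices to be inverted, and each
    inverse cancels one of them. *)
Lemma mean_mx_sub (M Mhat : 'M[R]_m) nu :
  1%:M - M \in unitmx -> 1%:M - Mhat \in unitmx ->
  mean_mx Mhat nu - mean_mx M nu =
  (invmx (1%:M - Mhat))^T *m ((Mhat - M)^T *m mean_mx M nu).
Proof.
move=> uM uMhat; set W := invmx (1%:M - Mhat).
have -> : Mhat - M = (1%:M - M) - (1%:M - Mhat).
  by rewrite opprB [RHS]addrC addrA subrK.
rewrite [(_ - _)^T]linearB/= mulmxBl mulmxBr.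
rewrite [in X in X - _]/mean_mx (mulmxA (1%:M - M)^T) -trmx_mul.
rewrite mulVmx// trmx1 mul1mx -/(mean_mx Mhat nu).
by rewrite !mulmxA -trmx_mul mulmxV// trmx1 mul1mx.
Qed.

(** By Lagrange's identity, twice the gap is a double sum of squares. *)
Lemma cauchy_schwarz_sum (I : finType) (a b : I -> R) :
  (\sum_i a i * b i) ^+ 2 <= (\sum_i a i ^+ 2) * (\sum_i b i ^+ 2).
Proof.
rewrite -subr_ge0 -(pmulr_rge0 _ (ltr0Sn R 1)).
suff -> : 2 * ((\sum_i a i ^+ 2) * (\sum_i b i ^+ 2) - (\sum_i a i * b i) ^+ 2)
    = \sum_i \sum_j (a i * b j - a j * b i) ^+ 2.
  by apply: sumr_ge0 => i _; apply: sumr_ge0 => j _; exact: sqr_ge0.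
have E i j : (a i * b j - a j * b i) ^+ 2 = a i ^+ 2 * b j ^+ 2
    + b i ^+ 2 * a j ^+ 2 - 2 * ((a i * b i) * (a j * b j)) by ring.
apply/esym; under eq_bigr => i _.
  under eq_bigr => j _ do rewrite E.
  rewrite big_split big_split/= sumrN -!mulr_sumr.
  over.
rewrite big_split big_split/= sumrN -!mulr_suml -!mulr_sumr -!mulr_suml.
by ring.
Qed.

Lemma norm2_sqr (v : 'cV[R]_m) : norm2 v ^+ 2 = \sum_k v k 0 ^+ 2.
Proof. by rewrite sqr_sqrtr// sumr_ge0// => k _; exact: sqr_ge0. Qed.

Lemma norm2_gt0 (v : 'cV[R]_m) : v != 0 -> 0 < norm2 v.
Proof.
move=> v0; rewrite sqrtr_gt0 lt_neqAle sumr_ge0 => [|k _]; last exact: sqr_ge0.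
rewrite andbT eq_sym; apply: contra v0; rewrite psumr_eq0 => [/allP v0|k _].
  apply/eqP/colP => k; rewrite mxE; apply/eqP.
  by have := v0 k (mem_index_enum _); rewrite sqrf_eq0.
exact: sqr_ge0.
Qed.

End AcyclicMatrix.

Section Rayleigh.
Variables (R : realType) (n : nat).
Implicit Types (M : 'M[R]_n.+1) (v : 'rV[R]_n.+1).

Definition qform M v : R := \sum_k \sum_l v 0 k * M k l * v 0 l.

Lemma qformE M v : qform M v = (v *m M *m v^T) 0 0.
Proof.
rewrite /qform mxE exchange_big/=; apply: eq_bigr => l _.
by rewrite !mxE mulr_suml.
Qed.

Let sq v : R := \sum_k v 0 k ^+ 2.

Lemma coord_continuous_rV (k : 'I_n.+1) : continuous (fun v : 'rV[R]_n.+1 => v 0 k).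
Proof. exact: coord_continuous. Qed.

Lemma sum_continuous (U : topologicalType) (I : finType) (f : I -> U -> R) :
  (forall i, continuous (f i)) -> continuous (fun x => \sum_i f i x).
Proof.
by move=> cf x; apply: cvg_big => [|i _]; [exact: (@add_continuous R^o)|exact: cf].
Qed.

Lemma mul_continuous_fun (U : topologicalType) (f g : U -> R) :
  continuous f -> continuous g -> continuous (fun x => f x * g x).
Proof. by move=> cf cg x; apply: continuousM; [exact: cf|exact: cg]. Qed.

Lemma qform_continuous M : continuous (qform M).
Proof.
apply: sum_continuous => k; apply: sum_continuous => l.
apply: mul_continuous_fun; last exact: coord_continuous_rV.
by apply: mul_continuous_fun; [exact: coord_continuous_rV|exact: cst_continuous].
Qed.

Lemma sq_continuous : continuous sq.
Proof.
apply: sum_continuous => k; under eq_fun do rewrite expr2.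
by apply: mul_continuous_fun; exact: coord_continuous_rV.
Qed.

Lemma sq_ge0 v : 0 <= sq v.
Proof. by apply: sumr_ge0 => k _; exact: sqr_ge0. Qed.

Lemma sq_gt0 v : v != 0 -> 0 < sq v.
Proof.
move=> v0; rewrite lt_neqAle sq_ge0 andbT eq_sym; apply: contra v0.
rewrite psumr_eq0 => [/allP v0|k _]; last exact: sqr_ge0.
apply/eqP/rowP => k; rewrite mxE; apply/eqP.
by have := v0 k (mem_index_enum _); rewrite sqrf_eq0.
Qed.

Lemma sqE v : sq v = (v *m v^T) 0 0.
Proof. by rewrite mxE; apply: eq_bigr => k _; rewrite mxE expr2. Qed.

Lemma qformZ M a v : qform M (a *: v) = a ^+ 2 * qform M v.
Proof. by rewrite !qformE linearZ/= -!scalemxAl -scalemxAr !mxE; ring. Qed.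

Lemma sqZ a v : sq (a *: v) = a ^+ 2 * sq v.
Proof. by rewrite !sqE linearZ/= -scalemxAl -scalemxAr !mxE; ring. Qed.

(** The continuous form attains its maximum on the compact unit sphere, and homogeneity carries it
    to all vectors. The quotients are cross-multiplied so that [u = 0] is covered. *)
Lemma rayleigh_max M : exists v : 'rV[R]_n.+1, v != 0 /\
  forall u, qform M u * sq v <= qform M v * sq u.
Proof.
pose S := [set v : 'rV[R]_n.+1 | sq v = 1].
have S0 : S !=set0.
  exists (delta_mx 0 0); rewrite /S /= /sq (bigD1 ord0)//= big1 => [|k k0].
    by rewrite mxE !eqxx expr1n addr0.
  by rewrite mxE (negbTE k0) andbF expr0n.
have cS : compact S.
  apply: bounded_closed_compact.
    exists 1; split => // x x1 v Sv; apply: ltW; apply: le_lt_trans x1.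
    rewrite [leLHS]/Num.norm/= mx_normrE; apply: bigmax_le => // -[i k] _ /=.
    rewrite ord1 -[leRHS]sqrtr1 -sqrtr_sqr ler_wsqrtr// -Sv /sq.
    by rewrite (bigD1 k)//= lerDl sumr_ge0// => j _; exact: sqr_ge0.
  have -> : S = sq @^-1` [set 1] by [].
  by apply: preimage_closed; [move=> x _; exact: sq_continuous|exact: closed_eq].
have [|v vS vmax] := compact_EVT_max S0 cS (f := qform M).
  exact/continuous_subspaceT/qform_continuous.
rewrite inE in vS; exists v; split.
  apply/eqP => v0; move: vS; rewrite /S/= /sq v0 big1 => [/esym/eqP|k _].
    by rewrite oner_eq0.
  by rewrite mxE expr0n.
move=> u; rewrite (vS : sq v = 1) mulr1.
have [->|u0] := eqVneq u 0.
  have := qformZ M 0 0; have := sqZ 0 0.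
  by rewrite !scale0r !expr0n !mul0r => -> ->; rewrite mulr0.
have squ := sq_gt0 u0.
have /vmax : (Num.sqrt (sq u))^-1 *: u \in S.
  by rewrite inE /S/= sqZ exprVn sqr_sqrtr ?sq_ge0// mulVf// gt_eqF.
by rewrite qformZ exprVn sqr_sqrtr ?sq_ge0// mulrC ler_pdivrMr.
Qed.

(** Moving from the zero [v] of the form in the direction [- v *m M] would decrease it at first
    order, against nonnegativity, unless [v *m M] vanishes. *)
Lemma psd_kernel M v : M^T = M -> (forall u, 0 <= qform M u) ->
  qform M v = 0 -> v *m M = 0.
Proof.
move=> symM psdM Mv0; pose w := v *m M.
have E (a : R) : qform M (a *: w + v) = a ^+ 2 * qform M w + 2 * a * sq w.
  have H : (w *m M *m v^T) 0 0 = sq w.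
    by rewrite sqE /w trmx_mul symM -!mulmxA.
  have H' : (v *m M *m w^T) 0 0 = sq w by rewrite sqE.
  have addE (A B : 'M[R]_1) : (A + B) 0 0 = A 0 0 + B 0 0 by rewrite mxE.
  have scaleE c (A : 'M[R]_1) : (c *: A) 0 0 = c * A 0 0 by rewrite mxE.
  rewrite qformE linearD/= linearZ/= !mulmxDl !mulmxDr -!scalemxAl -!scalemxAr.
  by rewrite !(addE, scaleE) -!qformE Mv0 H H'; ring.
have := sq_ge0 w; rewrite le_eqVlt => /orP[/eqP w0|w0].
  by have [//|/sq_gt0] := eqVneq w 0; rewrite -w0 ltxx.
exfalso; have qw := psdM w; have qw1 : 0 < qform M w + 1 by rewrite ltr_pwDr.
(* The [+ 1] keeps the denominator positive when [qform M w] vanishes; the value reached is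
   [- s^2 (q + 2) / (q + 1)^2], which is negative. *)
have := psdM (- (sq w / (qform M w + 1)) *: w + v); rewrite E.
set s := sq w; set q := qform M w.
have -> : (- (s / (q + 1))) ^+ 2 * q + 2 * (- (s / (q + 1))) * s =
   - (s ^+ 2 * ((q + 1) ^-1) ^+ 2 * (q + 2)).
  by field; rewrite gt_eqF.
rewrite oppr_ge0 leNgt mulr_gt0// ?ltr_wpDl//.
by rewrite mulr_gt0// exprn_gt0// invr_gt0.
Qed.

(** The maximal Rayleigh quotient [l] bounds every eigenvalue and is one itself: [l%:M - M] is
    positive semidefinite and its form vanishes at the maximizer, which [psd_kernel] puts in the
    kernel. *)
Lemma lambda_max_rayleigh M : M^T = M -> exists v : 'rV[R]_n.+1,
  v != 0 /\ qform M v = lambda_max M * sq v /\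
  forall u, qform M u <= lambda_max M * sq u.
Proof.
move=> symM; have [v [v0 vmax]] := rayleigh_max M.
have sqv := sq_gt0 v0; pose l := qform M v / sq v.
have le_l u : qform M u <= l * sq u.
  by rewrite /l mulrAC ler_pdivlMr.
have ubl : ubound [set a : R | eigenvalue M a] l.
  move=> a /eigenvalueP[u ua u0].
  have := le_l u; rewrite qformE ua -scalemxAl mxE -sqE ler_pM2r//.
  exact: sq_gt0.
have eigl : eigenvalue M l.
  apply/eigenvalueP; exists v => //; apply/eqP.
  rewrite -subr_eq0 -mul_mx_scalar -mulmxBr -oppr_eq0 -mulmxN opprB.
  have qE u : qform (l%:M - M) u = l * sq u - qform M u.
    rewrite !qformE mulmxBr mulmxBl mul_mx_scalar -scalemxAl sqE.
    by rewrite ![in LHS]mxE ![in RHS]mxE.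
  apply/eqP/psd_kernel; first by rewrite linearB/= tr_scalar_mx symM.
  - by move=> u; rewrite qE subr_ge0.
  - by rewrite qE /l divfK ?subrr// gt_eqF.
have lE : lambda_max M = l.
  apply/eqP; rewrite eq_le; apply/andP; split.
    by apply: ge_sup => //; exists l.
  by apply: ub_le_sup => //; exists l.
exists v; split=> //; split; first by rewrite lE /l divfK// gt_eqF.
by move=> u; rewrite lE.
Qed.

End Rayleigh.

(** * Measurability of matrix functions *)

Section MeasurableMatrix.
Context d (T : measurableType d) (R : realType).

Definition measurable_mx p q (M : T -> 'M[R]_(p, q)) :=
  forall i j, measurable_fun setT (fun w => M w i j).

Lemma measurable_inv (f : T -> R) : measurable_fun setT f ->
  measurable_fun setT (fun w => (f w)^-1).
Proof.
(* Squaring makes the base of the power function nonnegative, and the factor [f w] restores the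
   sign; where [f w = 0] both sides are 0, as [0^-1 = 0]. *)
move=> mf; rewrite (_ : (fun w => _) = (fun w => f w * (f w ^+ 2) `^ (- 1))).
  apply: measurable_funM => //; apply: (measurableT_comp (measurable_powR _)).
  exact: measurable_funX.
apply/funext => w; rewrite powR_inv1 ?sqr_ge0//.
have [->|f0] := eqVneq (f w) 0; first by rewrite invr0 mul0r.
by rewrite expr2 invfM mulrA divff// mul1r.
Qed.

Lemma measurable_sqrt (f : T -> R) : measurable_fun setT f ->
  measurable_fun setT (fun w => Num.sqrt (f w)).
Proof.
move=> mf.
rewrite (_ : (fun w => _) = (fun w => (Num.max (f w) 0) `^ (2^-1))).
  by apply: (measurableT_comp (measurable_powR _)); exact: measurable_maxr.
apply/funext => w; rewrite powR12_sqrt ?le_max ?lexx ?orbT//.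
have [//|/ltW f0] := leP 0 (f w).
by rewrite sqrtr0 ler0_sqrtr.
Qed.

Lemma measurable_mx_mul p q r (M : T -> 'M[R]_(p, q)) (N : T -> 'M[R]_(q, r)) :
  measurable_mx M -> measurable_mx N -> measurable_mx (fun w => M w *m N w).
Proof.
move=> mM mN i j; under eq_fun do rewrite mxE.
by apply: measurable_sum => k; exact: measurable_funM.
Qed.

Lemma measurable_mx_sub p q (M N : T -> 'M[R]_(p, q)) :
  measurable_mx M -> measurable_mx N -> measurable_mx (fun w => M w - N w).
Proof.
by move=> mM mN i j; under eq_fun do rewrite !mxE; apply: measurable_funB; [exact: mM|exact: mN].
Qed.

Lemma measurable_mx_cst p q (M : 'M[R]_(p, q)) : measurable_mx (fun=> M).
Proof. by move=> i j; exact: measurable_cst. Qed.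

Lemma measurable_mx_tr p q (M : T -> 'M[R]_(p, q)) :
  measurable_mx M -> measurable_mx (fun w => (M w)^T).
Proof. by move=> mM i j; under eq_fun do rewrite mxE; exact: mM. Qed.

Lemma measurable_det p (M : T -> 'M[R]_p) : measurable_mx M ->
  measurable_fun setT (fun w => \det (M w)).
Proof.
move=> mM; rewrite /determinant; apply: measurable_sum => s.
by apply: measurable_funM => //; apply: measurable_prod => i _; exact: mM.
Qed.

Lemma measurable_unitmx p (M : T -> 'M[R]_p) : measurable_mx M ->
  measurable_fun setT (fun w => M w \in unitmx).
Proof.
move=> mM; under eq_fun do rewrite unitmxE unitfE.
apply: measurable_neg; apply: measurable_fun_eqr => //; exact: measurable_det.
Qed.

Lemma measurable_mx_inv p (M : T -> 'M[R]_p) : measurable_mx M ->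
  measurable_mx (fun w => invmx (M w)).
Proof.
move=> mM i j.
(* Cramer's rule on invertible matrices; [invmx] returns a singular matrix unchanged, whence the
   second branch. *)
rewrite (_ : (fun w => _) = (fun w => if M w \in unitmx
    then (\det (M w))^-1 * cofactor (M w) j i else M w i j)).
  apply: measurable_fun_ifT; [exact: measurable_unitmx| |exact: mM].
  apply: measurable_funM; first by apply: measurable_inv; exact: measurable_det.
  apply: measurable_funM => //; apply: measurable_det => k l.
  by under eq_fun do rewrite !mxE; exact: mM.
by apply/funext => w; rewrite /invmx; case: ifP => _; rewrite ?mxE.
Qed.

Lemma measurable_norm2 p (v : T -> 'cV[R]_p) : measurable_mx v ->
  measurable_fun setT (fun w => norm2 (v w)).
Proof.
by move=> mv; apply: measurable_sqrt; apply: measurable_sum => k; exact: measurable_funX.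
Qed.

(** Used to freeze a random choice among finitely many values, such as the interventions or a
    declared parent set, on which even the sizes of the matrices depend. *)
Lemma measurable_fun_finType (I : finType) (a : T -> I) (f : I -> T -> R) :
  (forall i, measurable [set w | a w = i]) ->
  (forall i, measurable_fun setT (f i)) ->
  measurable_fun setT (fun w => f (a w) w).
Proof.
move=> ma mf.
rewrite (_ : (fun w => _) = (fun w => \sum_i \1_[set w | a w = i] w * f i w)).
  by apply: measurable_sum => i; apply: measurable_funM => //; exact: measurable_indic.
apply/funext => w; rewrite (bigD1 (a w))//= big1 => [|i ia].
  by rewrite addr0 indicE mem_set// mul1r.
by rewrite indicE memNset ?mul0r//= => /esym/eqP; rewrite (negbTE ia).
Qed.

Lemma measurable_finType (I : finType) (a : T -> I) (Q : I -> set T) :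
  (forall i, measurable [set w | a w = i]) -> (forall i, measurable (Q i)) ->
  measurable [set w | Q (a w) w].
Proof.
move=> ma mQ.
rewrite (_ : [set w | _] = \bigcup_(i in [set: I]) ([set w | a w = i] `&` Q i)).
  apply: fin_bigcup_measurable => // i _; exact: measurableI.
by apply/seteqP; split => [w Qw|w [i _ [/= <-]]//]; exists (a w).
Qed.

End MeasurableMatrix.

Section MeasurableLambdaMax.
Context d (T : measurableType d) (R : realType) (n : nat).

Lemma dense_rat_rV (A : set 'rV[R]_n.+1) : open A -> A !=set0 ->
  exists u : 'rV[rat]_n.+1, A (map_mx ratr u).
Proof.
move=> oA [v Av]; have /nbhs_ballP[e /= e0 veA] : nbhs v A.
  exact: open_nbhs_nbhs.
have /choice[u uP] (k : 'I_n.+1) : exists q : rat, ball (v 0 k) e (ratr q).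
  have : v 0 k - e < v 0 k + e by rewrite ltrBlDr -addrA ltrDl addr_gt0.
  move=> /rat_in_itvoo[q]; rewrite in_itv/= => /andP[q1 q2]; exists q.
  by rewrite /ball/= ltr_norml; apply/andP; split; lra.
exists (\row_k u k); apply: veA; split=> // i k.
by rewrite !ord1 !mxE; exact: uP.
Qed.

Lemma measurable_lambda_max (M : T -> 'M[R]_n.+1) :
  (forall w, (M w)^T = M w) -> measurable_mx M ->
  measurable_fun setT (fun w => lambda_max (M w)).
Proof.
move=> symM mM mD; apply: (measurability _ (RGenOInfty.measurableE R)) => //.
move=> _ [_ [y ->] <-]; rewrite setTI preimage_itvoy.
(* The vectors whose Rayleigh quotient exceeds [y] form an open set, so if there is one there is a
   rational one; this makes the union countable. *)
rewrite (_ : [set w | _] = \bigcup_(u : 'rV[rat]_n.+1)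
    [set w | y * (\sum_k (ratr (u 0 k)) ^+ 2) < qform (M w) (map_mx ratr u)]).
  apply: countable_bigcupT_measurable => [|u]; first exact: countableP.
  rewrite -[X in measurable X]setTI; apply: measurable_fun_ltr => //.
  apply: measurable_sum => k; apply: measurable_sum => l.
  by do 2 apply: measurable_funM => //; exact: mM.
apply/seteqP; split => w /=.
  move=> yl; have [v [v0 [vE _]]] := lambda_max_rayleigh (symM w).
  pose A := [set v : 'rV[R]_n.+1 | y * (\sum_k v 0 k ^+ 2) < qform (M w) v].
  have oA : open A.
    pose g (v : 'rV[R]_n.+1) := qform (M w) v - y * (\sum_k v 0 k ^+ 2).
    have -> : A = g @^-1` [set x | 0 < x].
      by apply/seteqP; split => u; rewrite /A /g/= subr_gt0.
    apply: open_comp; last exact: open_gt.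
    have cs : continuous (fun v : 'rV[R]_n.+1 => y * (\sum_k v 0 k ^+ 2)).
      by apply: mul_continuous_fun; [exact: cst_continuous|exact: sq_continuous].
    move=> u _; apply: (@continuousB _ R^o); first exact: qform_continuous.
    exact: cs.
  have [|u Au] := dense_rat_rV oA.
    by exists v; rewrite /A/= vE ltr_pM2r// sq_gt0.
  exists u => //; move: Au; rewrite /A/=.
  by under eq_bigr do rewrite mxE.
move=> [u _ /=]; set v := map_mx _ _; have [_ [_ [_ /(_ v)]]] := lambda_max_rayleigh (symM w).
have -> : \sum_k v 0 k ^+ 2 = \sum_k (ratr (u 0 k)) ^+ 2.
  by apply: eq_bigr => k _; rewrite mxE.
set S := \sum_k _ => h1 h2; have := lt_le_trans h2 h1.
have : 0 <= S by apply: sumr_ge0 => k _; exact: sqr_ge0.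
rewrite le_eqVlt => /orP[/eqP <-|S0]; first by rewrite !mulr0 ltxx.
by rewrite ltr_pM2r.
Qed.

End MeasurableLambdaMax.

(** * Exponential tilts and moments of the normal law *)

Lemma integral_density_signed d (T : measurableType d) (R : realType)
    (mu mu' : {measure set T -> \bar R}) (w : T -> R) :
  (forall x, 0 <= w x) ->
  (forall f : T -> \bar R, measurable_fun setT f -> (forall x, 0 <= f x)%E ->
    \int[mu]_x (f x * (w x)%:E) = \int[mu']_x f x)%E ->
  forall f : T -> \bar R, measurable_fun setT f ->
    (\int[mu]_x (f x * (w x)%:E) = \int[mu']_x f x)%E.
Proof.
move=> w0 H f mf; rewrite integralE [RHS]integralE.
have {}w0 x : (0 <= (w x)%:E)%E by rewrite lee_fin.
congr (_ - _)%E; rewrite -H//.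
- by apply: eq_integral => x _; rewrite !funeposE maxe_pMl ?mul0e.
- exact: measurable_funepos.
- by apply: eq_integral => x _; rewrite !funenegE -mulNe maxe_pMl ?mul0e.
- exact: measurable_funeneg.
Qed.

Section NormalMoments.
Variables (R : realType).
Local Notation leb := (@lebesgue_measure R).
Import HBNNSimple.

(** On indicators this is the definition of the normal law; simple functions follow by linearity and
    nonnegative ones by monotone convergence on both sides. *)
Lemma ge0_integral_normal_prob (m s : R) (f : measurableTypeR R -> \bar R) :
  measurable_fun setT f -> (forall x, 0 <= f x)%E ->
  (\int[normal_prob m s]_x f x = \int[leb]_x (f x * (normal_pdf m s x)%:E))%E.
Proof.
move=> mf f0.
have mpdf : measurable_fun setT (fun x => (normal_pdf m s x)%:E).
  by apply/measurable_EFinP; exact: measurable_normal_pdf.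
have pdf0 x : (0 <= (normal_pdf m s x)%:E)%E by rewrite lee_fin normal_pdf_ge0.
pose f_ := nnsfun_approx measurableT mf.
have cvgf x : ((f_ n x)%:E @[n --> \oo] --> f x)%E by exact: cvg_nnsfun_approx.
have ndf x : {homo (fun n => (f_ n x)%:E) : i j / (i <= j)%N >-> (i <= j)%E}.
  by move=> i j ij; rewrite lee_fin; exact/lefP/nd_nnsfun_approx.
transitivity (limn (fun n => \int[normal_prob m s]_x (f_ n x)%:E))%E.
  rewrite -monotone_convergence//.
  - by apply: eq_integral => x _; apply/esym/cvg_lim => //.
  - by move=> n; exact/measurable_EFinP.
  - by move=> n x _; rewrite lee_fin.
transitivity (limn (fun n =>
    \int[leb]_x ((f_ n x)%:E * (normal_pdf m s x)%:E)))%E; last first.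
  rewrite -monotone_convergence//.
  - apply: eq_integral => x _; apply/cvg_lim => //.
    by apply: cvgeZr.
  - move=> n; apply: emeasurable_funM => //.
    exact/measurable_EFinP.
  - by move=> n x _; rewrite mule_ge0// lee_fin.
  - by move=> x _ i j ij; apply: lee_wpmul2r => //; exact: ndf.
congr (limn _); apply/funext => n.
rewrite integralT_nnsfun sintegralE.
transitivity (\int[leb]_x (\sum_(k \in range (f_ n))
   ((k * \1_((f_ n @^-1` [set k])) x)%:E * (normal_pdf m s x)%:E)))%E; last first.
  apply: eq_integral => x _; rewrite [in RHS]fimfunE -fsumEFin// ge0_mule_fsuml//.
  by move=> k; exact: nnfun_muleindic_ge0.
rewrite ge0_integral_fsum//; last 2 first.
- move=> k; apply: emeasurable_funM => //; apply/measurable_EFinP.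
  by apply: measurable_funM.
- by move=> k x _; rewrite mule_ge0// nnfun_muleindic_ge0.
apply: eq_fsbigr => k; rewrite inE => -[x _ <-]; set k' := f_ n x.
under eq_integral do rewrite EFinM -muleA.
rewrite ge0_integralZl//; last 3 first.
- apply: emeasurable_funM => //; apply/measurable_EFinP.
  exact: measurable_indic.
- by move=> y _; rewrite mule_ge0// lee_fin.
- by rewrite lee_fin.
congr (_ * _)%E.
have H : (\int[leb]_(y in f_ n @^-1` [set k']) (normal_pdf m s y)%:E =
    \int[leb]_y ((\1_(f_ n @^-1` [set k']) y)%:E * (normal_pdf m s y)%:E))%E.
  rewrite [LHS]integral_mkcond; apply: eq_integral => y _; rewrite patchE indicE.
  by case: ifPn; rewrite ?mul1e ?mul0e.
exact: H.
Qed.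

Variables (m s : R).
Hypothesis s0 : s != 0.

(** Esscher transform: the density of the normal law of mean [m + c * s ^+ 2] with respect to the
    one of mean [m]. The moments below are all derived from these shifts of the mean. *)
Definition tilt (c x : R) : R := expR (c * (x - m) - c ^+ 2 * s ^+ 2 / 2).

Lemma measurable_tilt c : measurable_fun [set: R] (tilt c).
Proof.
apply: measurableT_comp => //; apply: measurable_funB => //.
by apply: measurable_funM => //; exact: measurable_funB.
Qed.

Lemma normal_pdf_tilt c x :
  normal_pdf m s x * tilt c x = normal_pdf (m + c * s ^+ 2) s x.
Proof.
rewrite !normal_pdfE// -mulrA /normal_fun /tilt -expRD; congr (_ * expR _).
by field.
Qed.

Lemma ge0_integral_tilt c (f : measurableTypeR R -> \bar R) :
  measurable_fun setT f -> (forall x, 0 <= f x)%E ->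
  (\int[normal_prob m s]_x (f x * (tilt c x)%:E) =
   \int[normal_prob (m + c * s ^+ 2) s]_x f x)%E.
Proof.
move=> mf f0; rewrite (ge0_integral_normal_prob (m + _))//.
rewrite ge0_integral_normal_prob.
- by apply: eq_integral => x _; rewrite -muleA -EFinM mulrC normal_pdf_tilt.
- by apply: emeasurable_funM => //; apply/measurable_EFinP; exact: measurable_tilt.
- by move=> x; rewrite mule_ge0// lee_fin expR_ge0.
Qed.

Lemma integral_tilt c (f : measurableTypeR R -> \bar R) :
  measurable_fun setT f ->
  (\int[normal_prob m s]_x (f x * (tilt c x)%:E) =
   \int[normal_prob (m + c * s ^+ 2) s]_x f x)%E.
Proof.
apply: integral_density_signed; first by move=> x; exact: expR_ge0.
exact: ge0_integral_tilt.
Qed.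

Lemma integral_tilt1 c : (\int[normal_prob m s]_x (tilt c x)%:E = 1)%E.
Proof.
transitivity (\int[normal_prob m s]_x (cst 1 x * (tilt c x)%:E))%E.
  by apply: eq_integral => x _; rewrite mul1e.
rewrite integral_tilt//= integral_cst// mul1e.
exact: (@probability_setT _ _ _ (normal_prob _ s)).
Qed.

Let N := normal_prob m s.

Lemma integrable_tilt c : N.-integrable setT (EFin \o tilt c).
Proof.
apply/integrableP; split; first by apply/measurable_EFinP; exact: measurable_tilt.
under eq_integral do rewrite /= ger0_norm ?expR_ge0//.
by rewrite integral_tilt1 ltry.
Qed.

Lemma integrable_le_tilt (f : R -> R) (a b K : R) : measurable_fun setT f ->
  (forall x, `|f x| <= K * (tilt a x + tilt b x)) ->
  N.-integrable setT (EFin \o f).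
Proof.
move=> mf fK; pose g := (fun x => (K * (tilt a x + tilt b x))%:E).
apply: (@le_integrable _ _ _ N _ measurableT _ g).
- exact/measurable_EFinP.
- by move=> x _; rewrite lee_fin (le_trans (fK x))// ler_norm.
- rewrite (_ : g = fun x => (K%:E * ((EFin \o tilt a) \+ (EFin \o tilt b)) x)%E)//.
  apply: integrableZl => //; apply: integrableD => //; exact: integrable_tilt.
Qed.

Lemma expRM_le_tilt c x : expR (c * (x - m)) = expR (c ^+ 2 * s ^+ 2 / 2) * tilt c x.
Proof. by rewrite -expRD; congr expR; ring. Qed.

Lemma normr_le_expR (y : R) : `|y| <= expR y + expR (- y).
Proof.
have h (z : R) : z <= expR z by apply: le_trans (expR_ge1Dx z); rewrite lerDr.
by rewrite ler_norml lerNl; apply/andP; split;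
  [rewrite (le_trans (h _))// lerDr expR_ge0|rewrite (le_trans (h _))// lerDl expR_ge0].
Qed.

(** The constant comes from squaring [z <= 2 * expR (z / 2)] for [z >= 0]. *)
Lemma sqr_le_expR (y : R) : y ^+ 2 <= 4 * (expR y + expR (- y)).
Proof.
have h (z : R) : 0 <= z -> z ^+ 2 <= 4 * expR z.
  move=> z0; have -> : 4 * expR z = (2 * expR (z / 2)) ^+ 2.
    rewrite exprMn -expRM_natl; congr (_ * expR _); last by field.
    by rewrite -natrX.
  rewrite ler_sqr ?nnegrE ?mulr_ge0 ?expR_ge0//.
  have := expR_ge1Dx (z / 2); lra.
have [y0|/ltW y0] := leP 0 y.
  by rewrite (le_trans (h _ y0))// ler_pM2l// lerDl expR_ge0.
rewrite -sqrrN (le_trans (h (- y) _)) ?oppr_ge0//.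
by rewrite ler_pM2l// lerDr expR_ge0.
Qed.

Let mctr : measurable_fun [set: R] (fun x => x - m).
Proof. exact: measurable_funB. Qed.

Let K0 := expR (s ^+ 2 / 2).

Lemma expR_pm_tilt x : expR (x - m) + expR (- (x - m)) = K0 * (tilt 1 x + tilt (-1) x).
Proof.
rewrite -[x - m]mul1r -mulNr !expRM_le_tilt sqrrN expr1n mul1r.
by rewrite mulrDr.
Qed.

Lemma integrable_center : N.-integrable setT (fun x => (x - m)%:E).
Proof.
apply: (@integrable_le_tilt (fun x => x - m) 1 (-1) K0) => // x.
by rewrite -expR_pm_tilt; exact: normr_le_expR.
Qed.

Lemma integrable_center_sqr : N.-integrable setT (fun x => ((x - m) ^+ 2)%:E).
Proof.
apply: (@integrable_le_tilt (fun x => (x - m) ^+ 2) 1 (-1) (4 * K0)) => [|x].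
  exact: measurable_funX.
by rewrite -mulrA -expR_pm_tilt ger0_norm ?sqr_ge0//; exact: sqr_le_expR.
Qed.

Lemma Rintegral_tilt c : \int[N]_x tilt c x = 1.
Proof. by rewrite /Rintegral integral_tilt1. Qed.

(** Integrating [1 + c * (x - m) <= expR (c * (x - m))] bounds [c * M] by a quantity of order
    [c ^+ 2], for [c] of either sign; a small [c] of the sign of [M] then forces [M = 0]. *)
Lemma Rintegral_center : \int[N]_x (x - m) = 0.
Proof.
set M := Rintegral _ _ _.
have h c : c * M <= expR (c ^+ 2 * s ^+ 2 / 2) - 1.
  rewrite lerBrDl; set K := expR _.
  have <- : \int[N]_x (K * tilt c x) = K.
    by rewrite RintegralZl ?Rintegral_tilt ?mulr1//; exact: integrable_tilt.
  have <- : \int[N]_x (1 + c * (x - m)) = 1 + c * M.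
    rewrite RintegralD//.
    - rewrite RintegralZl//; last exact: integrable_center.
      congr (_ + _); rewrite Rintegral_cst// mul1r.
      exact: (congr1 fine (@probability_setT _ _ _ (normal_prob m s))).
    - exact: finite_measure_integrable_cst.
    - by have := integrableZl measurableT c integrable_center.
  apply: le_Rintegral => //.
  - rewrite (_ : _ \o _ = fun x => 1%:E + c%:E * (x - m)%:E)%E//.
    apply: integrableD => //; first exact: finite_measure_integrable_cst.
    by have := integrableZl measurableT c integrable_center.
  - by have := integrableZl measurableT K (integrable_tilt c).
  - by move=> x _; rewrite -expRM_le_tilt expR_ge1Dx.
have s2 : 0 < s ^+ 2 by rewrite exprn_even_gt0.
apply/eqP/negPn/negP => M0.
have M2 : 0 < M ^+ 2 by rewrite exprn_even_gt0.
(* With the slope [M / D], the exponent [x] is at most [1 / 2], where [expR x - 1 <= 2 * x]; the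
   bound on [c * M] then reads [D <= s ^+ 2], which is false. *)
pose D := 2 * s ^+ 2 + M ^+ 2 * s ^+ 2 + 1.
have D0 : 0 < D by rewrite /D; nra.
pose x := (M / D) ^+ 2 * s ^+ 2 / 2.
have xE : x = M ^+ 2 * s ^+ 2 / (2 * D ^+ 2) by rewrite /x; field; rewrite gt_eqF.
have x12 : x <= 1 / 2.
  rewrite xE ler_pdivrMr; last by rewrite mulr_gt0// exprn_gt0.
  rewrite /D; nra.
have x0 : 0 <= x by rewrite xE divr_ge0// mulr_ge0// ltW// exprn_gt0.
have ex : expR x - 1 <= 2 * x.
  have := expR_ge1Dx (- x); rewrite expRN => h1.
  have ex0 := expR_gt0 x.
  have : (1 - x) * expR x <= 1.
    by rewrite -ler_pdivlMr// div1r.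
  nra.
have := le_trans (h (M / D)) ex; rewrite /x; set u := M / D.
have -> : M = u * D by rewrite /u divfK// gt_eqF.
have u2 : 0 < u ^+ 2 by rewrite exprn_even_gt0// mulf_neq0// invr_neq0// gt_eqF.
have Ds : s ^+ 2 < D by rewrite /D; nra.
by nra.
Qed.

End NormalMoments.

Definition normal_variance (R : realType) (m s : R) : R :=
  \int[normal_prob m s]_x ((x - m) ^+ 2).

Section NormalVariance.
Variables (R : realType) (m s : R).
Hypothesis s0 : s != 0.
Let N := normal_prob m s.
Local Notation tau := (tilt m s).

Lemma integrable_center_tilt c : N.-integrable setT (fun x => ((x - m) * tau c x)%:E).
Proof.
(* A factor [expR (x - m)] or its inverse turns the slope [c] into [c + 1] or [c - 1], at the price
   of one of the two constants summed in [K]. *)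
pose K := expR (s ^+ 2 / 2) * (expR (c * s ^+ 2) + expR (- (c * s ^+ 2))).
apply: (@integrable_le_tilt _ m s s0 (fun x => (x - m) * tau c x) (c + 1) (c - 1) K).
  by apply: measurable_funM; [exact: measurable_funB|exact: measurable_tilt].
move=> x; rewrite normrM (ger0_norm (expR_ge0 _)).
apply: (@le_trans _ _ ((expR (x - m) + expR (- (x - m))) * tau c x)).
  by rewrite ler_pM2r ?expR_gt0//; exact: normr_le_expR.
have E1 : expR (x - m) * tau c x
    = expR (s ^+ 2 / 2) * expR (c * s ^+ 2) * tau (c + 1) x.
  by rewrite /tilt -!expRD; congr expR; field.
have E2 : expR (- (x - m)) * tau c x
    = expR (s ^+ 2 / 2) * expR (- (c * s ^+ 2)) * tau (c - 1) x.
  by rewrite /tilt -!expRD; congr expR; field.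
rewrite mulrDl E1 E2 /K -subr_ge0.
set e1 := expR (c * _); set e2 := expR (- _); set e := expR _.
rewrite [X in 0 <= X](_ : _ = e * (e1 * tau (c - 1) x + e2 * tau (c + 1) x)).
  by rewrite mulr_ge0 ?addr_ge0 ?mulr_ge0 ?expR_ge0.
by ring.
Qed.

(** Under the tilted law the mean is [m + c * s ^+ 2], so only the shift survives. *)
Lemma Rintegral_center_tilt c : \int[N]_x ((x - m) * tau c x) = c * s ^+ 2.
Proof.
rewrite /Rintegral; under eq_integral do rewrite EFinM.
rewrite (@integral_tilt _ m s s0 c (fun x => (x - m)%:E)); last first.
  by apply/measurable_EFinP; exact: measurable_funB.
have I := @integrable_center _ (m + c * s ^+ 2) s s0.
have := @RintegralD _ _ _ (normal_prob (m + c * s ^+ 2) s) setT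
  (fun x => x - (m + c * s ^+ 2)) (cst (c * s ^+ 2)) measurableT I
  (finite_measure_integrable_cst _ _ _).
rewrite Rintegral_center// add0r Rintegral_cst//.
rewrite [X in fine X](@probability_setT _ _ _ (normal_prob (m + c * s ^+ 2) s)) mulr1.
move=> /(_ measurableT) H; rewrite -[RHS]H /Rintegral; congr fine.
by apply: eq_integral => x _; congr EFin; rewrite /=; ring.
Qed.

(** A larger variance only enlarges [Phi] and with it the error bound, so this is the direction that
    the tail estimate consumes. *)
Lemma normal_variance_ge : s ^+ 2 <= normal_variance m s.
Proof.
set v := normal_variance m s.
have s2 : 0 < s ^+ 2 by rewrite exprn_even_gt0.
have It c := integrable_tilt m s0 c.
have I2 := integrable_center_sqr m s0.
have I1 := integrable_center m s0.
(* Expand [y^2 + l^2 (w - 1)^2 >= 2 l y (w - 1)] for [y] the centered variable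
   and [w] its exponential tau. *)
have key c l : 2 * l * c * s ^+ 2 <= v + l ^+ 2 * (expR (c ^+ 2 * s ^+ 2) - 1).
  pose K := expR (c ^+ 2 * s ^+ 2).
  pose F x := (x - m) ^+ 2 + (l ^+ 2 * K * tau (2 * c) x - 2 * l ^+ 2 * tau c x + l ^+ 2).
  pose G x := 2 * l * ((x - m) * tau c x) - 2 * l * (x - m).
  have IZ (f : R -> R) k : N.-integrable setT (EFin \o f) ->
      N.-integrable setT (EFin \o (fun x => k * f x)).
    by move=> If; have := integrableZl measurableT k If.
  have ID (f g : R -> R) : N.-integrable setT (EFin \o f) ->
      N.-integrable setT (EFin \o g) ->
      N.-integrable setT (EFin \o (fun x => f x + g x)).
    by move=> If Ig; have := integrableD measurableT If Ig.
  have IB (f g : R -> R) : N.-integrable setT (EFin \o f) ->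
      N.-integrable setT (EFin \o g) ->
      N.-integrable setT (EFin \o (fun x => f x - g x)).
    by move=> If Ig; have := integrableB measurableT If Ig.
  have Ic k : N.-integrable setT (EFin \o (fun=> k)).
    exact: finite_measure_integrable_cst.
  have IF1 := IB _ _ (IZ _ (l ^+ 2 * K) (It (2 * c))) (IZ _ (2 * l ^+ 2) (It c)).
  have IF2 := ID _ _ IF1 (Ic (l ^+ 2)).
  have IF := ID (fun x => (x - m) ^+ 2) _ I2 IF2.
  have IG1 := IZ (fun x => (x - m) * tau c x) (2 * l) (integrable_center_tilt c).
  have IG2 := IZ (fun x => x - m) (2 * l) I1.
  have IG := IB _ _ IG1 IG2.
  have EF : \int[N]_x F x = v + l ^+ 2 * (K - 1).
    rewrite /F RintegralD// RintegralD// RintegralB//; last 2 first.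
    - exact: IZ (It _).
    - exact: IZ (It _).
    rewrite !RintegralZl// !Rintegral_tilt// Rintegral_cst//.
    rewrite [X in fine X](@probability_setT _ _ _ (normal_prob m s)).
    by rewrite -/(normal_variance m s) -/v /= mulr1; ring.
  have EG : \int[N]_x G x = 2 * l * c * s ^+ 2.
    rewrite /G RintegralB// RintegralZl//; last exact: integrable_center_tilt.
    rewrite RintegralZl// Rintegral_center// Rintegral_center_tilt.
    by ring.
  rewrite -EG -EF; apply: le_Rintegral => // x _.
  rewrite /F /G -subr_ge0.
  have -> : l ^+ 2 * K * tau (2 * c) x = l ^+ 2 * tau c x ^+ 2.
    rewrite -mulrA; congr (_ * _).
    by rewrite /K /tilt -expRD -expRM_natl; congr expR; field.
  rewrite [X in 0 <= X](_ : _ = ((x - m) - l * (tau c x - 1)) ^+ 2).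
    exact: sqr_ge0.
  by ring.
(* [key] is applied with [c ^+ 2 * s ^+ 2 = x] and [l = (1 - x) / c]: its left side is
   [2 * (1 - x) * s ^+ 2], and [(1 - x) * (expR x - 1) <= x] bounds the correction by half of
   that. *)
have lt_v x : 0 < x < 1 -> (1 - x) * s ^+ 2 <= v.
  move=> /andP[x0 x1]; pose c := Num.sqrt (x / s ^+ 2).
  have c2 : c ^+ 2 = x / s ^+ 2 by rewrite sqr_sqrtr// divr_ge0// ltW.
  have c0 : c != 0.
    by rewrite -sqrf_eq0 c2 mulf_neq0 ?gt_eqF// invr_gt0.
  have cx : c ^+ 2 * s ^+ 2 = x by rewrite c2 divfK// gt_eqF.
  have := key c ((1 - x) / c); rewrite cx.
  have -> : 2 * ((1 - x) / c) * c * s ^+ 2 = 2 * (1 - x) * s ^+ 2 by field.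
  have ex : (1 - x) * (expR x - 1) <= x.
    have := expR_ge1Dx (- x); rewrite expRN => h1.
    have ex0 := expR_gt0 x.
    have : (1 - x) * expR x <= 1 by rewrite -ler_pdivlMr// div1r.
    lra.
  have -> : ((1 - x) / c) ^+ 2 * (expR x - 1)
      = (1 - x) * ((1 - x) * (expR x - 1)) * (c ^+ 2)^-1 by field.
  rewrite c2 invf_div => h.
  have : (1 - x) * ((1 - x) * (expR x - 1)) * (s ^+ 2 / x) <= (1 - x) * s ^+ 2.
    rewrite [leLHS](_ : _ = (1 - x) * s ^+ 2 * ((1 - x) * (expR x - 1) / x)).
      apply: ler_piMr; first by apply: mulr_ge0; rewrite ?subr_ge0 ltW.
      by rewrite ler_pdivrMr// mul1r.
    by field; rewrite gt_eqF.
  lra.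
rewrite leNgt; apply/negP => vs.
have v0 : 0 <= v by apply: Rintegral_ge0 => // x _; exact: sqr_ge0.
(* For this [x] the lower bound is the midpoint of [v] and [s ^+ 2], which exceeds [v]. *)
have /lt_v : 0 < (s ^+ 2 - v) / (2 * s ^+ 2) < 1.
  apply/andP; split; first by apply: divr_gt0; [rewrite subr_gt0|exact: mulr_gt0].
  rewrite ltr_pdivrMr; last exact: mulr_gt0.
  rewrite mul1r (@le_lt_trans _ _ (s ^+ 2))//.
    by rewrite lerBlDr lerDl.
  by rewrite ltr_pMl// ltr1n.
rewrite mulrBl mul1r mulrAC.
have -> : (s ^+ 2 - v) * s ^+ 2 / (2 * s ^+ 2) = (s ^+ 2 - v) / 2 by field.
by lra.
Qed.

End NormalVariance.

(** * Integration of functions of independent variables *)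

Section Freezing.
Context d d1 d2 (T : measurableType d) (D1 : measurableType d1)
  (D2 : measurableType d2) (R : realType) (P : probability T R).
Variables (Y : {mfun T >-> D1}) (X : {mfun T >-> D2}).
Hypothesis indep : forall E Q, measurable E -> measurable Q ->
  (P (Y @^-1` E `&` X @^-1` Q) = P (Y @^-1` E) * P (X @^-1` Q))%E.

Let Z0 w := (Y w, X w).
Let mZ0 : measurable_fun setT Z0. Proof. exact: measurable_fun_pair. Qed.
Let Z_mixin := isMeasurableFun.Build _ _ _ _ Z0 mZ0.
Let Z : {mfun T >-> (D1 * D2)%type} := HB.pack Z0 Z_mixin.
Let mY := distribution P Y.
Let mX := distribution P X.

Let ZE (B : set (D1 * D2)%type) : measurable B -> distribution P Z B = (mY \x mX)%E B.
Proof.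
move=> mB; apply/esym; apply: (@product_measure_unique _ _ _ _ _ mY mX) => //.
Qed.

(** By independence the joint law is the product of the laws, and Tonelli integrates the second
    variable with the first one frozen. *)
Lemma ge0_integral_freeze (f : D1 * D2 -> \bar R) : measurable_fun setT f ->
  (forall z, 0 <= f z)%E ->
  (\int[P]_w f (Y w, X w) = \int[P]_w \int[mX]_x f (Y w, x))%E.
Proof.
move=> mf f0; transitivity (\int[distribution P Z]_z f z)%E.
  by rewrite ge0_integral_distribution.
rewrite (eq_measure_integral (mY \x mX)%E); last first.
  by move=> B mB _; rewrite [LHS]ZE.
rewrite fubini_tonelli1//.
rewrite (@ge0_integral_distribution _ _ _ _ _ _ Y (fubini_F mX f))//.
- exact: measurable_fun_fubini_tonelli_F.
- by move=> y; exact: integral_ge0.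
Qed.

(** Freezing applied to the absolute values gives integrability of the product, which licenses
    Fubini for the signed integral. *)
Lemma integral_mul_indep (f : D1 -> R) (g : D2 -> R) :
  measurable_fun setT f -> measurable_fun setT g ->
  P.-integrable setT (fun w => (f (Y w))%:E) ->
  P.-integrable setT (fun w => (g (X w))%:E) ->
  P.-integrable setT (fun w => (f (Y w) * g (X w))%:E) /\
  (\int[P]_w (f (Y w) * g (X w))%:E =
    (\int[P]_w (f (Y w))%:E) * (\int[P]_w (g (X w))%:E))%E.
Proof.
move=> mf mg If Ig.
have mfg : measurable_fun setT (fun z : D1 * D2 => f z.1 * g z.2).
  by apply: measurable_funM; apply: measurableT_comp.
have iG : mX.-integrable setT (EFin \o g).
  by apply: integrable_pushforward => //; exact/measurable_EFinP.
have iF : mY.-integrable setT (EFin \o f).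
  by apply: integrable_pushforward => //; exact/measurable_EFinP.
have absE : (\int[P]_w (`|f (Y w) * g (X w)|)%:E =
    (\int[P]_w (`|f (Y w)|)%:E) * (\int[mX]_x (`|g x|)%:E))%E.
  rewrite (@ge0_integral_freeze (fun z => (`|f z.1 * g z.2|)%:E))//=; first last.
  - by apply/measurable_EFinP; exact: measurableT_comp.
  have g0 : (0 <= \int[mX]_x (`|g x|)%:E)%E.
    by apply: integral_ge0 => x _; rewrite lee_fin.
  have m1 : measurable_fun setT (fun w => (`|f (Y w)|)%:E).
    by apply/measurable_EFinP; do 2 apply: measurableT_comp => //.
  have m2 : measurable_fun setT (fun x => (`|g x|)%:E).
    by apply/measurable_EFinP; apply: measurableT_comp.
  have p1 w : [set: T] w -> (0 <= (`|f (Y w)|)%:E)%E by rewrite lee_fin.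
  have p2 x : [set: D2] x -> (0 <= (`|g x|)%:E)%E by rewrite lee_fin.
  rewrite -ge0_integralZr//; apply: eq_integral => w _.
  rewrite -ge0_integralZl//.
  by apply: eq_integral => x _; rewrite normrM EFinM.
have I : P.-integrable setT (fun w => (f (Y w) * g (X w))%:E).
  apply/integrableP; split.
  by apply/measurable_EFinP; apply: measurable_funM; apply: measurableT_comp.
  under eq_integral do rewrite abse_EFin.
  rewrite absE; apply: lte_mul_pinfty.
  - by apply: integral_ge0 => x _; rewrite lee_fin.
  - by apply: integrable_fin_num => //; exact: integrable_norm.
  - by case/integrableP: iG.
split=> //.
transitivity (\int[distribution P Z]_z (f z.1 * g z.2)%:E)%E.
  by rewrite integral_distribution//; apply/measurable_EFinP.
rewrite (eq_measure_integral (mY \x mX)%E); last first.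
  by move=> B mB _; rewrite [LHS]ZE.
rewrite -integral12_prod_meas1; last first.
  apply/integrableP; split; first exact/measurable_EFinP.
  rewrite (eq_measure_integral (distribution P Z)); last first.
    by move=> B mB _; rewrite [RHS]ZE.
  have /(integrable_pushforward mZ0) : P.-integrable (Z0 @^-1` setT)
      ((fun z : D1 * D2 => (f z.1 * g z.2)%:E) \o Z0) by [].
  by move=> /(_ _ measurableT) /integrableP[] //; exact/measurable_EFinP.
transitivity (\int[mY]_y ((f y)%:E * \int[mX]_x (g x)%:E))%E.
  apply: eq_integral => y _; rewrite /fubini_F/=.
  by under eq_integral do rewrite EFinM; rewrite integralZl.
have gfin : (\int[mX]_x (g x)%:E)%E \is a fin_num by exact: integrable_fin_num.
under eq_integral do rewrite -(fineK gfin).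
rewrite integralZr// fineK//.
rewrite integral_distribution//; last exact/measurable_EFinP.
by rewrite integral_distribution//; exact/measurable_EFinP.
Qed.

End Freezing.

Section IndependentSigma.
Context d (T : measurableType d) (R : realType) (P : probability T R).
Variables (G : set (set T)).
Hypotheses (Gm : G `<=` measurable) (GI : setI_closed G) (GT : G setT).

(** As functions of [E] both sides are finite measures, and they agree on a generating pi-system. *)
Lemma indep_g_sigma_algebra (Q : set T) : measurable Q ->
  (forall E, G E -> P (E `&` Q) = P E * P Q)%E ->
  forall E, <<s G >> E -> (P (E `&` Q) = P E * P Q)%E.
Proof.
move=> mQ GQ E GE.
have PQ0 : (0 <= fine (P Q))%R by rewrite fine_ge0.
have PQE : P Q = (NngNum PQ0)%:num%:E by rewrite /= fineK// fin_num_measure.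
pose m1 := mrestr P mQ; pose m2 := mscale (NngNum PQ0) P.
rewrite muleC PQE; apply: (@g_sigma_algebra_measure_unique _ _ _ G Gm (fun=> setT) _ _ m1 m2) => //.
- by rewrite bigcup_const//; exists 0%N.
- by move=> A GA; apply: (etrans (GQ A GA)); rewrite muleC; exact: (congr1 (fun x => x * P A)%E PQE).
- move=> _; apply: (@le_lt_trans _ _ 1%E); last exact: ltry.
  by apply: probability_le1; exact: measurableI.
Qed.

End IndependentSigma.

Notation "G .-mfun f" :=
  (measurable_fun [set: g_sigma_algebraType G] (f : g_sigma_algebraType G -> _))
  (at level 2).

Section GaussianVariable.
Context d (T : measurableType d) (R : realType) (P : probability T R).
Variables (X : {RV P >-> R}) (m sg : R).
Hypothesis sg0 : sg != 0.
Hypothesis law : forall Q : set R, measurable Q ->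
  distribution P X Q = normal_prob m sg Q.

Let idR : measurableTypeR R -> R := idfun.
Let midR : measurable_fun setT idR.
Proof. by move=> _ Q mQ; rewrite setTI preimage_id. Qed.

Lemma ge0_integral_gauss (f : R -> \bar R) : measurable_fun [set: R] f ->
  (forall x, 0 <= f x)%E ->
  (\int[P]_w f (X w) = \int[normal_prob m sg]_x f x)%E.
Proof.
move=> mf f0; transitivity (\int[distribution P X]_x f x)%E.
  by rewrite ge0_integral_distribution.
rewrite (eq_measure_integral (pushforward (normal_prob m sg) idR)).
  by rewrite ge0_integral_pushforward.
by move=> Q mQ _; rewrite [LHS]law.
Qed.

Lemma integral_gauss (f : R -> \bar R) : measurable_fun [set: R] f ->
  (\int[P]_w f (X w) = \int[normal_prob m sg]_x f x)%E.
Proof.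
move=> mf; rewrite integralE [RHS]integralE; congr (_ - _)%E.
  rewrite -ge0_integral_gauss//; last exact: measurable_funepos.
  by apply: eq_integral => w _; rewrite !funeposE.
rewrite -ge0_integral_gauss//; last exact: measurable_funeneg.
by apply: eq_integral => w _; rewrite !funenegE.
Qed.

Lemma integrable_gauss (f : R -> \bar R) : measurable_fun [set: R] f ->
  (normal_prob m sg).-integrable setT f ->
  P.-integrable setT (fun w => f (X w)).
Proof.
move=> mf /integrableP[_ If]; apply/integrableP; split.
  exact: measurableT_comp.
rewrite (@ge0_integral_gauss (fun x => `|f x|)%E)//.
exact: measurableT_comp.
Qed.

Let mctr : measurable_fun [set: R] (fun x : R => x - m).
Proof. exact: measurable_funB. Qed.

Lemma gauss_center : P.-integrable setT (fun w => (X w - m)%:E) /\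
  (\int[P]_w (X w - m)%:E = 0)%E.
Proof.
have mf : measurable_fun [set: R] (fun x : R => (x - m)%:E).
  exact/measurable_EFinP.
have Ic := integrable_center m sg0.
split; first exact: (integrable_gauss mf Ic).
rewrite (integral_gauss mf) -(fineK (integrable_fin_num _ Ic))//.
by congr EFin; exact: Rintegral_center.
Qed.

Lemma gauss_center_sqr : P.-integrable setT (fun w => ((X w - m) ^+ 2)%:E) /\
  (\int[P]_w ((X w - m) ^+ 2)%:E = (normal_variance m sg)%:E)%E.
Proof.
have mf : measurable_fun [set: R] (fun x : R => ((x - m) ^+ 2)%:E).
  by apply/measurable_EFinP; exact: measurable_funX.
have Ic := integrable_center_sqr m sg0.
split; first exact: (integrable_gauss mf Ic).
by rewrite (integral_gauss mf) /normal_variance /Rintegral fineK//; exact: (integrable_fin_num _ Ic).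
Qed.

Lemma gauss_tilt c : (\int[P]_w (tilt m sg c (X w))%:E = 1)%E.
Proof.
have mt : measurable_fun [set: R] (fun x => (tilt m sg c x)%:E).
  by apply/measurable_EFinP; exact: measurable_tilt.
by rewrite (integral_gauss mt); exact: integral_tilt1.
Qed.

End GaussianVariable.

Section IndependentOfSigma.
Context d (T : measurableType d) (R : realType) (P : probability T R).
Variables (H : set (set T)) (X : {RV P >-> R}).
Hypothesis HT : <<s H >> `<=` measurable.
Hypothesis indep : forall E Q, <<s H >> E -> measurable Q ->
  (P (E `&` X @^-1` Q) = P E * P (X @^-1` Q))%E.

Let TH := g_sigma_algebraType H.
(** The identity into [T] equipped with the smaller sigma-algebra is a random variable, and
    independence of [X] from the sigma-algebra becomes independence of two random variables. *)
Let idH : T -> TH := idfun.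
Let midH : measurable_fun setT idH.
Proof. by move=> _ Q mQ; rewrite setTI preimage_id; exact: HT. Qed.
Let idH_mixin := isMeasurableFun.Build _ _ _ _ idH midH.
Let Y : {mfun T >-> TH} := HB.pack idH idH_mixin.

Lemma integral_mul_indep_sigma (f : T -> R) (g : R -> R) :
  H.-mfun f -> measurable_fun setT g ->
  P.-integrable setT (EFin \o f) -> P.-integrable setT (fun w => (g (X w))%:E) ->
  P.-integrable setT (fun w => (f w * g (X w))%:E) /\
  (\int[P]_w (f w * g (X w))%:E =
    (\int[P]_w (f w)%:E) * (\int[P]_w (g (X w))%:E))%E.
Proof.
move=> mf mg If Ig.
by apply: (@integral_mul_indep _ _ _ T TH R R P Y X).
Qed.

Variables (m sg : R).
Hypothesis sg0 : sg != 0.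
Hypothesis law : forall Q : set R, measurable Q ->
  distribution P X Q = normal_prob m sg Q.

(** One step of the exponential martingale: with the slope frozen, the tilt has mean 1 under the law
    of [X]. *)
Lemma integral_mul_tilt (f l : T -> R) :
  H.-mfun f -> H.-mfun l -> (forall w, 0 <= f w) ->
  (\int[P]_w (f w * tilt m sg (l w) (X w))%:E = \int[P]_w (f w)%:E)%E.
Proof.
move=> mf ml f0.
pose F (z : TH * R) := (f z.1 * tilt m sg (l z.1) z.2)%:E.
rewrite (@ge0_integral_freeze _ _ _ T TH R R P Y X _ F)//.
- apply: eq_integral => w _; rewrite /F/=.
  under eq_integral do rewrite EFinM.
  rewrite ge0_integralZl//.
  + transitivity ((f w)%:E * 1)%E; last by rewrite mule1.
    congr (_ * _)%E; rewrite -(@gauss_tilt _ _ _ P X m sg sg0 law (l w)).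
    by rewrite ge0_integral_distribution//; [apply/measurable_EFinP;
      exact: measurable_tilt|move=> x; rewrite lee_fin expR_ge0].
  + by apply/measurable_EFinP; exact: measurable_tilt.
  + by move=> x _; rewrite lee_fin expR_ge0.
  + by rewrite lee_fin.
- apply/measurable_EFinP; apply: measurable_funM.
    exact: (measurableT_comp mf).
  apply: measurableT_comp => //.
  have ml1 : measurable_fun setT (fun z : TH * R => l z.1).
    exact: (measurableT_comp ml).
  apply: measurable_funB.
    by apply: measurable_funM => //; exact: measurable_funB.
  by do 2 apply: measurable_funM => //; exact: measurable_funX.
- by move=> z; rewrite lee_fin mulr_ge0// expR_ge0.
Qed.

End IndependentOfSigma.

(** * Uniqueness of conditional expectations *)

Section IndicatorIntegral.
Context d (T : measurableType d) (R : realType) (mu : {measure set T -> \bar R}).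
Implicit Types (E : set T) (f : T -> R).

Let patch_indic E f : (EFin \o f) \_ E = (fun w => (\1_E w * f w)%:E).
Proof.
apply/funext => w; rewrite patchE indicE.
by case: ifPn; rewrite ?mul1r ?mul0r.
Qed.

Lemma integral_indic_mul E f :
  (\int[mu]_(w in E) (f w)%:E = \int[mu]_w (\1_E w * f w)%:E)%E.
Proof. by rewrite integral_mkcond -patch_indic. Qed.

Lemma integrable_indic_mul E f : measurable E ->
  mu.-integrable E (EFin \o f) <-> mu.-integrable setT (fun w => (\1_E w * f w)%:E).
Proof. by move=> mE; rewrite -patch_indic; exact: integrable_mkcond. Qed.

End IndicatorIntegral.

Section ConditionalExpectation.
Context d (T : measurableType d) (R : realType) (P : probability T R).
Variable G : set (set T).
Hypothesis GT : <<s G >> `<=` measurable.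

Lemma sigma_setI B C : <<s G >> B -> <<s G >> C -> <<s G >> (B `&` C).
Proof. exact: (@measurableI _ (g_sigma_algebraType G)). Qed.

Lemma sigma_le (u v : T -> R) : G.-mfun u -> G.-mfun v ->
  <<s G >> [set w | u w <= v w].
Proof.
move=> mu mv; rewrite -[X in <<s _ >> X]setTI.
exact: (@measurable_fun_ler _ (g_sigma_algebraType G) R setT u v mu mv measurableT).
Qed.

Lemma bounded_integrable (f : T -> R) (E : set T) (K : R) : measurable E ->
  measurable_fun setT f -> (forall w, E w -> `|f w| <= K) ->
  P.-integrable E (EFin \o f).
Proof.
move=> mE mf fK; apply: measurable_bounded_integrable => //.
- by rewrite (le_lt_trans (probability_le1 P mE))// ltry.
- exact: measurable_funTS.
- exists K; split; first exact: num_real.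
  by move=> x Kx w Ew; rewrite /= (le_trans (fK w Ew))// ltW.
Qed.

(** On a set of constant sign of [g - k] where both are bounded, equal integrals make the integral
    of [|g - k|] vanish. Countably many such sets cover almost everything. *)
Lemma cond_expectation_unique (f g k : T -> R) (F : nat -> set T) :
  cond_expectation P <<s G >> f g -> G.-mfun k ->
  (forall n, <<s G >> (F n)) -> (\forall w \ae P, exists n, F n w) ->
  (forall n E, <<s G >> E -> E `<=` F n -> P.-integrable E (EFin \o f) /\
     (\int[P]_(w in E) (f w)%:E = \int[P]_(w in E) (k w)%:E)%E) ->
  \forall w \ae P, g w = k w.
Proof.
move=> [gG _ fg] mk GF Fcover fk.
have mg : G.-mfun g by move=> _ Q mQ; rewrite setTI; exact: gG.
have mgT : measurable_fun setT g by move=> ? Q mQ; apply: GT; exact: mg.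
have mkT : measurable_fun setT k by move=> ? Q mQ; apply: GT; exact: mk.
(* The truncation makes [g] and [k] integrable, and these sets stay in the sigma-algebra because [g]
   and [k] are measurable for it. *)
pose A n N := F n `&` [set w | `|g w| <= N%:R /\ `|k w| <= N%:R].
have claim n N E : <<s G >> E -> E `<=` A n N ->
    (forall w, E w -> 0 <= g w - k w) \/ (forall w, E w -> g w - k w <= 0) ->
    \forall w \ae P, E w -> g w = k w.
  move=> GE EA sgn; have mE := GT GE.
  have [If fkE] := fk n E GE (fun w Ew => (EA w Ew).1).
  have Ig : P.-integrable E (EFin \o g).
    by apply: (@bounded_integrable _ _ N%:R) => // w /EA[_ []].
  have Ik : P.-integrable E (EFin \o k).
    by apply: (@bounded_integrable _ _ N%:R) => // w /EA[_ []].
  have gk : (\int[P]_(w in E) (g w)%:E = \int[P]_(w in E) (k w)%:E)%E.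
    by rewrite -fg// fkE.
  have fin : (\int[P]_(w in E) (k w)%:E)%E \is a fin_num by exact: integrable_fin_num.
  have B1 : (\int[P]_(w in E) (g w - k w)%:E = 0)%E.
    by rewrite integralB_EFin// gk subee.
  have B2 : (\int[P]_(w in E) (k w - g w)%:E = 0)%E.
    by rewrite integralB_EFin// gk subee.
  have B : (\int[P]_(w in E) `|(g w - k w)%:E| = 0)%E.
    case: sgn => sgn; [rewrite -[RHS]B1|rewrite -[RHS]B2]; apply: eq_integral => w;
      rewrite inE => Ew /=.
      by rewrite ger0_norm ?sgn.
    by rewrite ler0_norm ?sgn// opprB.
  have mgk : measurable_fun E (fun w => (g w - k w)%:E).
    by apply/measurable_EFinP; apply: measurable_funTS; exact: measurable_funB.
  have /(ae_eq_integral_abs P mE mgk) := B.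
  apply: filterS => w h Ew.
  by have /= := h Ew => -[/eqP]; rewrite subr_eq0 => /eqP.
have GA n N : <<s G >> (A n N).
  apply: sigma_setI => //; apply: sigma_setI; apply: sigma_le => //.
    exact: measurableT_comp.
  exact: measurableT_comp.
have clA n N : \forall w \ae P, A n N w -> g w = k w.
  have H1 : \forall w \ae P, (A n N `&` [set w | k w <= g w]) w -> g w = k w.
    apply: (claim n N); last by left => w [_ /=]; rewrite subr_ge0.
      by apply: sigma_setI => //; exact: sigma_le.
    by move=> w [].
  have H2 : \forall w \ae P, (A n N `&` [set w | g w <= k w]) w -> g w = k w.
    apply: (claim n N); last by right => w [_ /=]; rewrite subr_le0.
      by apply: sigma_setI => //; exact: sigma_le.
    by move=> w [].
  apply: filterS2 H1 H2 => w h1 h2 Aw.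
  by have /orP[h|h] := le_total (k w) (g w); [exact: h1|exact: h2].
have : \forall w \ae P, forall n N, A n N w -> g w = k w.
  by apply: ae_foralln => n; apply: ae_foralln => N; exact: clA.
apply: filterS2 Fcover => w [n Fn] h.
pose N := (Num.truncn (`|g w| + `|k w|)).+1.
have hN : `|g w| + `|k w| <= N%:R by apply/ltW; exact: truncnS_gt.
apply: (h n N); split=> //; split; apply: le_trans hN.
  by rewrite lerDl.
by rewrite lerDr.
Qed.

End ConditionalExpectation.

(** * Conditionally Gaussian sums *)

Section ConditionallyGaussian.
Context d (T : measurableType d) (R : realType) (P : probability T R).
Variables (t : nat) (X : 'I_t -> {RV P >-> R}) (m sg : R).
Variables (G : set (set T)) (H : 'I_t -> set (set T)).
Hypothesis sg0 : 0 < sg.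
Hypothesis law : forall s (Q : set R), measurable Q ->
  distribution P (X s) Q = normal_prob m sg Q.
Hypothesis GH : forall s, <<s G >> `<=` <<s H s >>.
Hypothesis HT : forall s, <<s H s >> `<=` measurable.
Hypothesis GT : <<s G >> `<=` measurable.
Hypothesis HX : forall s s', s' != s -> (H s).-mfun (X s').
Hypothesis indep : forall s E Q, <<s H s >> E -> measurable Q ->
  (P (E `&` X s @^-1` Q) = P E * P (X s @^-1` Q))%E.

Let sgN0 : sg != 0. Proof. by rewrite gt_eqF. Qed.

Lemma mfun_GH s (f : T -> R) : G.-mfun f -> (H s).-mfun f.
Proof. by move=> mf _ Q mQ; apply: GH; exact: mf. Qed.

Lemma mfun_GT (f : T -> R) : G.-mfun f -> measurable_fun setT f.
Proof. by move=> mf _ Q mQ; apply: GT; exact: mf. Qed.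

(** All the factors but that of [s] are measurable for [H s], from which [X s] is independent, so
    the factor of [s] can be removed without changing the integral. Any order of removal works, as
    [H s] carries every other step. *)
Lemma integral_prod_tilt (l : 'I_t -> T -> R) (r : seq 'I_t) :
  (forall s, G.-mfun (l s)) -> uniq r ->
  (\int[P]_w (\prod_(s <- r) tilt m sg (l s w) (X s w))%:E = 1)%E.
Proof.
move=> ml; elim: r => [_|s r IH /= /andP[sr ur]].
  under eq_integral do rewrite big_nil.
  by rewrite integral_cst// mul1e; exact: probability_setT.
rewrite -[RHS]IH//.
have mt s' : s' != s -> (H s).-mfun (fun w => tilt m sg (l s' w) (X s' w)).
  move=> s's; apply: measurableT_comp => //.
  have ml' := mfun_GH (s := s) (ml s'); apply: measurable_funB.
    by apply: measurable_funM => //; apply: measurable_funB => //; exact: HX.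
  by do 2 apply: measurable_funM => //; exact: measurable_funX.
pose f w := \prod_(s' <- r) tilt m sg (l s' w) (X s' w).
have mf : (H s).-mfun f.
  by apply: measurable_prod => s' s'r; apply: mt; apply: contra sr => /eqP <-.
have f0 w : 0 <= f w by apply: prodr_ge0 => s' _; exact: expR_ge0.
rewrite -(integral_mul_tilt (@HT s) (@indep s) sgN0 (@law s) mf
  (mfun_GH (ml s)) f0).
by apply: eq_integral => w _; rewrite big_cons mulrC.
Qed.

Let y s w := X s w - m.

Lemma mfun_sum (I : finType) (f : I -> T -> R) :
  (forall s, G.-mfun (f s)) -> G.-mfun (fun w => \sum_s f s w).
Proof. by move=> mf; exact: measurable_sum. Qed.

Let my s : measurable_fun setT (y s).
Proof. by apply: measurable_funB. Qed.

(** Chernoff's bound with a product of tilts, of integral 1, in place of the exponential moment. *)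
Lemma subgaussian_tail (l : 'I_t -> T -> R) (r : R) :
  (forall s, G.-mfun (l s)) -> (forall w, \sum_s l s w ^+ 2 <= 1) -> 0 <= r ->
  (P [set w | (r * sg <= \sum_s l s w * y s w)%R] <= (expR (- (r ^+ 2 / 2)))%:E)%E.
Proof.
move=> ml l1 r0; set E := [set w | _].
have mE : measurable E.
  rewrite /E -[X in measurable X]setTI; apply: measurable_fun_ler => //.
  by apply: measurable_sum => s; apply: measurable_funM => //; exact: mfun_GT.
(* This slope maximizes the exponent [c * r * sg - c ^+ 2 * sg ^+ 2 / 2], with value
   [r ^+ 2 / 2]. *)
pose c := r / sg; pose M w := \prod_s tilt m sg (c * l s w) (X s w).
have mcl s : G.-mfun (fun w => c * l s w) by exact: measurable_funM.
have mM : measurable_fun setT M.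
  apply: measurable_prod => s _; apply: measurableT_comp => //.
  have mcl' := mfun_GT (mcl s); apply: measurable_funB.
    by apply: measurable_funM => //; exact: measurable_funB.
  by do 2 apply: measurable_funM => //; exact: measurable_funX.
have M0 w : 0 <= M w by apply: prodr_ge0 => s' _; exact: expR_ge0.
have IM : (\int[P]_w (M w)%:E = 1)%E.
  by apply: (integral_prod_tilt mcl); exact: index_enum_uniq.
have ME w : E w -> expR (r ^+ 2 / 2) <= M w.
  rewrite /E/= => Ew; rewrite /M -expR_sum ler_expR.
  have -> : \sum_s (c * l s w * (X s w - m) - (c * l s w) ^+ 2 * sg ^+ 2 / 2) =
      c * (\sum_s l s w * y s w) - r ^+ 2 / 2 * \sum_s l s w ^+ 2.
    rewrite !mulr_sumr -sumrB; apply: eq_bigr => s _.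
    by rewrite /c /y; field.
  have c0 : 0 <= c by rewrite divr_ge0// ltW.
  have h1 : c * (r * sg) <= c * (\sum_s l s w * y s w) by exact: ler_wpM2l.
  have h2 : c * (r * sg) = r ^+ 2 by rewrite /c; field.
  have h3 : r ^+ 2 / 2 * \sum_s l s w ^+ 2 <= r ^+ 2 / 2.
    by rewrite ler_piMr// divr_ge0// sqr_ge0.
  lra.
have : ((expR (r ^+ 2 / 2))%:E * P E <= 1)%E.
  rewrite -IM -integral_cst//.
  apply: (@le_trans _ _ (\int[P]_(w in E) (M w)%:E)%E).
    apply: ge0_le_integral => //.
    - by move=> w _; rewrite lee_fin expR_ge0.
    - by apply/measurable_EFinP; exact: measurable_funTS.
  apply: ge0_subset_integral => //; last by move=> w _; rewrite lee_fin.
  exact/measurable_EFinP.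
by rewrite expRN muleC -lee_pdivlMr ?expR_gt0// mul1e.
Qed.

(** Dividing the coefficients by their norm reduces to [subgaussian_tail]; where the norm vanishes
    the quotients are 0, whence the bound [<= 1] there instead of an equality. The two signs give
    the factor 2. *)
Lemma gaussian_tail (l : 'I_t -> T -> R) (r : R) :
  (forall s, G.-mfun (l s)) -> 0 <= r ->
  (P [set w | 0 < \sum_s l s w ^+ 2 /\
     r * sg * Num.sqrt (\sum_s l s w ^+ 2) <= `|\sum_s l s w * y s w| ]%R
   <= (2 * expR (- (r ^+ 2 / 2)))%:E)%E.
Proof.
move=> ml r0; pose z w := Num.sqrt (\sum_s l s w ^+ 2); set E := [set w | _].
have q0 w : 0 <= \sum_s l s w ^+ 2 by apply: sumr_ge0 => s _; exact: sqr_ge0.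
have mq : G.-mfun (fun w => \sum_s l s w ^+ 2).
  by apply: mfun_sum => s; exact: measurable_funX.
have mz : G.-mfun (fun w => (z w)^-1).
  rewrite (_ : (fun w => _) = fun w => (\sum_s l s w ^+ 2) `^ (- 2^-1)).
    exact: (measurableT_comp (measurable_powR _)).
  by apply/funext => w; rewrite powRN powR12_sqrt.
pose l1 s w := l s w * (z w)^-1; pose l2 s w := - l1 s w.
have ml1 s : G.-mfun (l1 s) by exact: measurable_funM.
have ml2 s : G.-mfun (l2 s) by exact: measurable_funN.
have n1 w : \sum_s l1 s w ^+ 2 <= 1.
  under eq_bigr do rewrite exprMn.
  rewrite -mulr_suml exprVn sqr_sqrtr//.
  by have [->|h] := eqVneq (\sum_s l s w ^+ 2) 0; rewrite ?mul0r// divff.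
have n2 w : \sum_s l2 s w ^+ 2 <= 1 by under eq_bigr do rewrite sqrrN.
have := leeD (subgaussian_tail ml1 n1 r0) (subgaussian_tail ml2 n2 r0).
rewrite -EFinD -mulr2n mulr_natl; apply: le_trans.
set E1 := [set w | _]; set E2 := [set w | _].
have mE (l' : 'I_t -> T -> R) : (forall s, G.-mfun (l' s)) ->
    measurable [set w | r * sg <= \sum_s l' s w * y s w].
  move=> ml'; rewrite -[X in measurable X]setTI; apply: measurable_fun_ler => //.
  by apply: measurable_sum => s; apply: measurable_funM => //; exact: mfun_GT.
have m1 : measurable E1 by exact: mE.
have m2 : measurable E2 by exact: mE.
have mz' : measurable_fun setT z.
  have -> : z = (fun w => (\sum_s l s w ^+ 2) `^ (2^-1)).
    by apply/funext => w; rewrite powR12_sqrt.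
  by apply: (measurableT_comp (measurable_powR _)); exact: mfun_GT.
have mEE : measurable E.
  apply: measurableI.
    rewrite -[X in measurable X]setTI; apply: measurable_fun_ltr => //.
    exact: mfun_GT.
  rewrite -[X in measurable X]setTI; apply: measurable_fun_ler => //.
    exact: measurable_funM.
  apply: measurableT_comp => //; apply: measurable_sum => s.
  by apply: measurable_funM => //; exact: mfun_GT.
apply: (@le_trans _ _ (P (E1 `|` E2))).
  apply: le_measure; rewrite ?inE//; first exact: measurableU.
  move=> w [zw]; rewrite -/(z w) => hw.
  have z0 : 0 < z w by rewrite sqrtr_gt0.
  have S1 : \sum_s l1 s w * y s w = (\sum_s l s w * y s w) / z w.
    by rewrite mulr_suml; apply: eq_bigr => s _; rewrite /l1 mulrAC.
  have S2 : \sum_s l2 s w * y s w = - ((\sum_s l s w * y s w) / z w).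
    by rewrite -S1 -sumrN; apply: eq_bigr => s _; rewrite /l2 mulNr.
  have [h|/ltW h] := leP 0 (\sum_s l s w * y s w); [left|right].
    by rewrite /E1/= S1 ler_pdivlMr// (le_trans hw)// ger0_norm.
  by rewrite /E2/= S2 -mulNr ler_pdivlMr// (le_trans hw)// ler0_norm.
exact: measureU2.
Qed.

Lemma integral_mul_center s (B : T -> R) : (H s).-mfun B ->
  P.-integrable setT (EFin \o B) ->
  P.-integrable setT (fun w => (B w * y s w)%:E) /\
  (\int[P]_w (B w * y s w)%:E = 0)%E.
Proof.
move=> mB IB; have [Iy y0] := gauss_center sgN0 (@law s).
have mctr : measurable_fun setT (fun x : R => x - m) by exact: measurable_funB.
have [I E] := integral_mul_indep_sigma (@HT s) (@indep s) mB mctr IB Iy.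
by split=> //; rewrite [LHS]E y0 mule0.
Qed.

Let intG (B : T -> R) (K : R) : G.-mfun B -> (forall w, `|B w| <= K) ->
  P.-integrable setT (EFin \o B).
Proof.
by move=> mB BK; apply: (@bounded_integrable _ _ _ _ _ _ K) => //; exact: mfun_GT.
Qed.

(** For equal steps the variance factors out. For distinct ones [y s] joins the factor measurable
    for [H s'], and the centered [y s'] kills the integral. *)
Lemma integral_mul_center2 s s' (B : T -> R) (K : R) : G.-mfun B ->
  (forall w, `|B w| <= K) ->
  P.-integrable setT (fun w => (B w * (y s w * y s' w))%:E) /\
  (\int[P]_w (B w * (y s w * y s' w))%:E
    = (s == s')%:R%:E * (normal_variance m sg)%:E * \int[P]_w (B w)%:E)%E.
Proof.
move=> mB BK; have IB := intG mB BK.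
have [<-|ss'] := eqVneq s s'.
  have [Iy2 y2] := gauss_center_sqr sgN0 (@law s).
  have mctr : measurable_fun setT (fun x : R => (x - m) ^+ 2).
    by apply: measurable_funX; exact: measurable_funB.
  have [I E] := integral_mul_indep_sigma (@HT s) (@indep s) (mfun_GH (s := s) mB)
    mctr IB Iy2.
  split=> //; rewrite mul1e muleC -y2 -E.
  by apply: eq_integral => w _; rewrite expr2.
have [I1 _] := integral_mul_center (mfun_GH (s := s) mB) IB.
have mBy : (H s').-mfun (fun w => B w * y s w).
  apply: measurable_funM; first exact: mfun_GH.
  by apply: measurable_funB => //; exact: HX.
have [I2 E2] := integral_mul_center mBy I1.
rewrite !mul0e; split; last rewrite -[RHS]E2.
  by under eq_fun do rewrite mulrA.
by apply: eq_integral => w _; rewrite mulrA.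
Qed.

Let indicM E (f : T -> R) (K : R) : <<s G >> E -> G.-mfun f ->
  (forall w, E w -> `|f w| <= K) ->
  G.-mfun (fun w => \1_E w * f w) /\ forall w, `|\1_E w * f w| <= `|K|.
Proof.
move=> GE mf fK; split.
  by apply: measurable_funM => //; exact: (@measurable_indic _ (g_sigma_algebraType G)).
move=> w; rewrite indicE; case: (asboolP (E w)) => Ew.
  by rewrite mem_set// mul1r (le_trans (fK w Ew))// ler_norm.
by rewrite memNset// mul0r normr0.
Qed.

Variables (L L' : 'I_t -> T -> R) (c c' v v' e e' : T -> R).
Hypotheses (mL : forall s, G.-mfun (L s)) (mL' : forall s, G.-mfun (L' s)).
Hypotheses (mc : G.-mfun c) (mc' : G.-mfun c').
Hypotheses (vE : forall w, v w = c w + \sum_s L s w * y s w).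
Hypotheses (vE' : forall w, v' w = c' w + \sum_s L' s w * y s w).

(** On the sets [F n] the coefficients are bounded, so [v] is integrable there and the centered
    noise terms integrate to 0; these sets exhaust [T]. *)
Lemma cond_mean : cond_expectation P <<s G >> v e -> \forall w \ae P, e w = c w.
Proof.
move=> ce; pose b w := `|c w| + \sum_s `|L s w|.
have mb : G.-mfun b.
  apply: measurable_funD; first exact: measurableT_comp.
  by apply: mfun_sum => s; exact: measurableT_comp.
pose F n := [set w | b w <= n%:R].
apply: (@cond_expectation_unique _ _ _ _ _ GT v e c F) => //.
- by move=> n; exact: sigma_le.
- apply: aeW => w; exists (Num.truncn (b w)).+1.
  by apply/ltW; exact: truncnS_gt.
move=> n E GE EF; have mE := GT GE.
have cK w : E w -> `|c w| <= n%:R.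
  by move=> /EF; apply: le_trans; rewrite /b lerDl sumr_ge0.
have LK s w : E w -> `|L s w| <= n%:R.
  move=> /EF; apply: le_trans; rewrite /b (bigD1 s)//= addrCA lerDl.
  by rewrite addr_ge0// sumr_ge0.
have [mc1 c1K] := indicM GE mc cK; have Ic := intG mc1 c1K.
have ILy s := integral_mul_center (mfun_GH (s := s) (indicM GE (mL s) (@LK s)).1)
  (intG (indicM GE (mL s) (@LK s)).1 (indicM GE (mL s) (@LK s)).2).
have IS : P.-integrable setT (fun w => \sum_s (\1_E w * L s w * y s w)%:E)%E.
  by apply: integrable_sum => // s _; exact: (ILy s).1.
have vEE w : (\1_E w * v w)%:E =
    ((\1_E w * c w)%:E + \sum_s (\1_E w * L s w * y s w)%:E)%E.
  rewrite vE mulrDr EFinD mulr_sumr -sumEFin; congr (_ + _)%E.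
  by apply: eq_bigr => s _; rewrite mulrA.
split.
  apply/(integrable_indic_mul _ _ mE); under eq_fun do rewrite vEE.
  exact: integrableD.
rewrite [LHS]integral_indic_mul [RHS]integral_indic_mul; under eq_integral do rewrite vEE.
rewrite integralD// integral_sum//; last by move=> s; exact: (ILy s).1.
by rewrite big1 ?adde0// => s _; exact: (ILy s).2.
Qed.

Lemma cond_cov (C : T -> R) : G.-mfun e -> G.-mfun e' ->
  (\forall w \ae P, e w = c w) -> (\forall w \ae P, e' w = c' w) ->
  cond_expectation P <<s G >> (fun w => (v w - e w) * (v' w - e' w)) C ->
  \forall w \ae P, C w = normal_variance m sg * \sum_s L s w * L' s w.
Proof.
move=> me me' ec ec' ce; pose b w := \sum_s \sum_s' `|L s w * L' s' w|.
have mb : G.-mfun b.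
  apply: mfun_sum => s; apply: mfun_sum => s'; apply: measurableT_comp => //.
  exact: measurable_funM.
pose k w := normal_variance m sg * \sum_s L s w * L' s w.
have mk : G.-mfun k.
  by apply: measurable_funM => //; apply: mfun_sum => s; exact: measurable_funM.
(* The equalities [e = c] and [e' = c'] hold only almost everywhere; they are built into the sets,
   as pairs of inequalities measurable for [G], so the sets cover [T] up to a null set. *)
pose F n := [set w | b w <= n%:R] `&`
  (([set w | e w <= c w] `&` [set w | c w <= e w]) `&`
   ([set w | e' w <= c' w] `&` [set w | c' w <= e' w])).
apply: (cond_expectation_unique GT ce (F := F)) => //.
- by move=> n; repeat apply: sigma_setI; exact: sigma_le.
- apply: filterS2 ec ec' => w ew ew'; exists (Num.truncn (b w)).+1.
  by split; [apply/ltW; exact: truncnS_gt|rewrite /= ew ew' !lexx].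
move=> n E GE EF; have mE := GT GE.
have LK s s' w : E w -> `|L s w * L' s' w| <= n%:R.
  move=> /EF[]; rewrite /= => bn _; apply: le_trans bn.
  rewrite /b (bigD1 s)//= (bigD1 s')//= -addrA lerDl.
  by rewrite addr_ge0// sumr_ge0// => ? _; rewrite sumr_ge0.
have mLL s s' : G.-mfun (fun w => L s w * L' s' w) by exact: measurable_funM.
have IL s s' := integral_mul_center2 s s' (indicM GE (mLL s s') (@LK s s')).1
  (indicM GE (mLL s s') (@LK s s')).2.
pose h s s' w := (\1_E w * (L s w * L' s' w) * (y s w * y s' w))%:E.
have vEE w : (\1_E w * ((v w - e w) * (v' w - e' w)))%:E =
    (\sum_s \sum_s' h s s' w)%E.
  rewrite /h; case: (asboolP (E w)) => Ew; last first.
    rewrite indicE memNset// mul0r big1// => s _; rewrite big1// => s' _.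
    by rewrite !mul0r.
  have [_ [[/= e1 e2] [/= e3 e4]]] := EF w Ew.
  have -> : e w = c w by apply/eqP; rewrite eq_le e1.
  have -> : e' w = c' w by apply/eqP; rewrite eq_le e3.
  rewrite vE vE' ![_ + _ - _]addrAC !subrr !add0r mulr_suml mulr_sumr -sumEFin.
  apply: eq_bigr => s _; rewrite mulr_sumr mulr_sumr -sumEFin.
  by apply: eq_bigr => s' _; congr EFin; ring.
have Ih s s' : P.-integrable setT (h s s') by exact: (IL s s').1.
have Is s : P.-integrable setT (fun w => \sum_s' h s s' w)%E.
  by apply: integrable_sum.
split.
  apply/(integrable_indic_mul _ _ mE); under eq_fun do rewrite vEE.
  by apply: integrable_sum.
rewrite [LHS]integral_indic_mul [RHS]integral_indic_mul; under eq_integral do rewrite vEE.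
rewrite integral_sum//.
have IB s : P.-integrable setT (fun w => (\1_E w * (L s w * L' s w))%:E).
  exact: (intG (indicM GE (mLL s s) (@LK s s)).1 (indicM GE (mLL s s) (@LK s s)).2).
transitivity (\sum_s (normal_variance m sg)%:E * \int[P]_w (\1_E w * (L s w * L' s w))%:E)%E.
  apply: eq_bigr => s _; rewrite integral_sum// (bigD1 s)//= big1 => [|s' s's].
    by rewrite adde0 [LHS](IL s s).2 eqxx mul1e.
  by rewrite [LHS](IL s s').2 eq_sym (negbTE s's) !mul0e.
have kE w : (\1_E w * k w)%:E =
    (\sum_s (normal_variance m sg)%:E * (\1_E w * (L s w * L' s w))%:E)%E.
  rewrite /k mulrCA mulr_sumr mulr_sumr -sumEFin.
  by apply: eq_bigr => s _; rewrite EFinM.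
under [in RHS]eq_integral do rewrite kE.
rewrite integral_sum//; last by move=> s; exact: integrableZl.
by apply: eq_bigr => s _; rewrite integralZl.
Qed.

End ConditionallyGaussian.

(** * Least squares in the structural equation model *)

Section Design.
Variables (R : realType) (m t : nat).
Implicit Types (x : 'M[R]_(m, t)) (c : policy m t) (i : 'I_m) (b : bool).
Implicit Types (S : {set 'I_m}) (beta : 'I_m -> R).

(* The regressors, with the steps of the wrong intervention status zeroed out
   instead of removed: its shape does not depend on the interventions. *)
Definition design x c i b S : 'M[R]_(#|S|, t) :=
  \matrix_(p, s) (if c s i == b then x (enum_val p) s else 0).

Lemma sum_steps c i b (F : 'I_t -> R) :
  \sum_(q < #|steps c i b|) F (enum_val q) = \sum_s (if c s i == b then F s else 0).
Proof.
rewrite -(big_enum_val F) big_mkcond.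
by apply: eq_bigr => s _; rewrite inE.
Qed.

Lemma gram_design x c i b S :
  gram x c i b S = design x c i b S *m (design x c i b S)^T.
Proof.
apply/matrixP => p q; rewrite !mxE.
under eq_bigr do rewrite !mxE.
rewrite (sum_steps c i b (fun s => x (enum_val p) s * x (enum_val q) s)).
by apply: eq_bigr => s _; rewrite !mxE; case: ifP; rewrite ?mulr0.
Qed.

Lemma mmse_coef_design x c nu i b S : mmse_coef x c nu i b S =
  invmx (gram x c i b S) *m (design x c i b S *m \col_s (x i s - nu i 0)).
Proof.
rewrite /mmse_coef -mulmxA; congr (_ *m _); apply/matrixP => p q; rewrite !mxE.
under eq_bigr do rewrite !mxE.
rewrite (sum_steps c i b (fun s => x (enum_val p) s * (x i s - nu i 0))).
by apply: eq_bigr => s _; rewrite !mxE; case: ifP; rewrite ?mul0r.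
Qed.

(** The entries of [(D D^T)^-1 D], extended by zero outside [S]: the weight of the noise of step [s]
    in the error on the edge from [k]. *)
Definition noise_coef x c i b S (k : 'I_m) (s : 'I_t) : R :=
  \sum_(p < #|S| | enum_val p == k)
    (invmx (design x c i b S *m (design x c i b S)^T) *m design x c i b S) p s.

(** Zero once the Gram matrix is invertible. It is kept because [invmx] of a singular matrix is not
    an inverse, while the error decomposition has to hold at every outcome and for every candidate
    [S]. *)
Definition bias x c i b S beta (k : 'I_m) : R :=
  \sum_(p < #|S| | enum_val p == k)
    (invmx (design x c i b S *m (design x c i b S)^T) *m
     (design x c i b S *m (design x c i b S)^T) *m
      \col_(p < #|S|) beta (enum_val p)) p 0 - beta k.

(** As [S] contains the support of [beta], the response at the retained steps is the design applied
    to [beta] plus noise, and least squares is linear in the response. *)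
Lemma mmse_error x c nu i b S beta (eta : 'I_t -> R) :
  (forall k, beta k != 0 -> k \in S) ->
  (forall s, c s i = b -> x i s = \sum_k beta k * x k s + eta s) ->
  forall k, mmse_col x c nu i b S k 0 - beta k =
    bias x c i b S beta k + \sum_s noise_coef x c i b S k s * (eta s - nu i 0).
Proof.
move=> betaS xE k; rewrite /mmse_col mxE /bias addrAC; congr (_ - _).
set D := design x c i b S; set G := D *m D^T.
have DE : D *m \col_s (x i s - nu i 0) =
    D *m (D^T *m \col_p beta (enum_val p)) + D *m \col_s (eta s - nu i 0).
  rewrite -mulmxDr; apply/matrixP => p q; rewrite !mxE; apply: eq_bigr => s _.
  rewrite /D ![design _ _ _ _ _ _ _]mxE; case: eqP => [cs|_]; last by rewrite !mul0r.
  congr (_ * _); rewrite !mxE xE// -addrA; congr (_ + _).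
  transitivity (\sum_(j in S) beta j * x j s).
    rewrite [RHS]big_mkcond; apply: eq_bigr => j _; case: ifPn => // jS.
    by have [->|/betaS] := eqVneq (beta j) 0; rewrite ?mul0r// (negbTE jS).
  rewrite big_enum_val; apply: eq_bigr => r _.
  by rewrite !mxE cs eqxx mulrC.
have E p : mmse_coef x c nu i b S p 0 =
    (invmx G *m G *m \col_p beta (enum_val p)) p 0 +
    \sum_s (invmx G *m D) p s * (eta s - nu i 0).
  rewrite mmse_coef_design gram_design -/D -/G DE mulmxDr mxE !mulmxA.
  congr (_ + _); rewrite mxE; apply: eq_bigr => s _.
  by rewrite [in X in _ * X]mxE.
under eq_bigr do rewrite E.
rewrite big_split/=; congr (_ + _); rewrite exchange_big/=.
by apply: eq_bigr => s _; rewrite /noise_coef mulr_suml.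
Qed.

Lemma enum_val_eq S k (kS : k \in S) (p : 'I_#|S|) :
  (enum_val p == k) = (p == enum_rank_in kS k).
Proof.
apply/eqP/eqP => [pk|->]; last by rewrite enum_rankK_in.
by apply: enum_val_inj; rewrite enum_rankK_in.
Qed.

Lemma bias_eq0 x c i b S beta : (forall k, beta k != 0 -> k \in S) ->
  gram x c i b S \in unitmx -> forall k, bias x c i b S beta k = 0.
Proof.
move=> betaS; rewrite gram_design /bias; set D := design x c i b S => uG k.
rewrite mulVmx// mul1mx; have [kS|kS] := boolP (k \in S).
  rewrite (big_pred1 (enum_rank_in kS k)) => [|p].
    by rewrite mxE enum_rankK_in// subrr.
  exact: enum_val_eq.
rewrite big_pred0 => [|p]; last first.
  by apply/negbTE; apply: contra kS => /eqP <-; exact: enum_valP.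
by rewrite sub0r; apply/eqP; rewrite oppr_eq0; apply: contraNT kS; exact: betaS.
Qed.

(** The row of [k] in [(D D^T)^-1 D] times the corresponding column of [D^T] is 1, so the row is
    nonzero. *)
Lemma noise_coef_neq0 x c i b S k : gram x c i b S \in unitmx -> k \in S ->
  exists s, noise_coef x c i b S k s != 0.
Proof.
rewrite gram_design => uG kS; apply: contrapT => /forallNP H.
have H0 s : (invmx (design x c i b S *m (design x c i b S)^T) *m
    design x c i b S) (enum_rank_in kS k) s = 0.
  have /negP/negPn/eqP := H s; rewrite /noise_coef.
  rewrite (big_pred1 (enum_rank_in kS k))// => p.
  exact: enum_val_eq.
have := mulVmx uG; rewrite mulmxA => /matrixP/(_ (enum_rank_in kS k) (enum_rank_in kS k)).
rewrite !mxE eqxx big1 => [/esym/eqP|s _]; first by rewrite oner_eq0.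
by rewrite H0 mul0r.
Qed.

End Design.

(** * The structural equations and their exogenous candidate parent sets *)

Section Model.
Variables (R : realType) (m t : nat) (B B' : 'M[R]_m).
Hypothesis dag : forall c : intervention m, acyclic (parents (post_mx B B' c)).

Lemma post_rank (c : intervention m) : exists h : 'I_m -> nat,
  forall k i, post_mx B B' c k i != 0 -> (h k < h i)%N.
Proof.
have [h hP] := acyclic_rank (@dag c); exists h => k i ki.
by apply: hP; rewrite inE.
Qed.

Lemma post_unitmx (c : intervention m) : 1%:M - post_mx B B' c \in unitmx.
Proof. by have [h hP] := post_rank c; exact: one_sub_unitmx hP. Qed.

Definition sem_mx c : 'M[R]_m := invmx (1%:M - post_mx B B' c).

Lemma sem_solution (x : 'M[R]_(m, t)) (c : policy m t) s (e : 'I_m -> R) :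
  col s x = (post_mx B B' (c s))^T *m col s x + \col_i e i ->
  forall k, x k s = \sum_j sem_mx (c s) j k * e j.
Proof.
move=> xE k; have uM := post_unitmx (c s).
have : (1%:M - post_mx B B' (c s))^T *m col s x = \col_i e i.
  by rewrite linearB/= trmx1 mulmxBl mul1mx {1}xE addrAC subrr add0r.
move=> /(congr1 (mulmx (sem_mx (c s))^T)).
rewrite mulmxA -trmx_mul mulmxV// trmx1 mul1mx => /matrixP/(_ k 0).
by rewrite !mxE => ->; apply: eq_bigr => j _; rewrite !mxE.
Qed.

(* Candidate parent sets that create no endogeneity. *)
Definition admissible (a : intervention m) (i : 'I_m) (S : {set 'I_m}) :=
  parents (post_mx B B' a) i \subset S /\
  forall (c : intervention m) k, c i = a i -> k \in S ->
    ~~ connect (fun k i => k \in parents (post_mx B B' c) i) i k.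

Lemma sem_mx_eq0 a i S (c : intervention m) k : admissible a i S ->
  c i = a i -> k \in S -> sem_mx c i k = 0.
Proof.
move=> [_ ndS] ci kS; have [h hP] := post_rank c.
pose e : rel 'I_m := fun k i => k \in parents (post_mx B B' c) i.
apply: (invmx_one_sub_eq0 (D := [set k | connect e i k]%SET) hP).
- move=> j l; rewrite !inE => ij jl; apply: connect_trans ij _.
  by apply: connect1; rewrite /e inE.
- by rewrite inE connect0.
- by rewrite inE; exact: ndS.
Qed.

(** If a declared parent of [i] were a true descendant of [i], the true path would consist of
    declared edges, and the declared edge back to [i] would close a cycle in the estimated graph of
    the same intervention. *)
Lemma admissible_Phat (Phat : 'I_m -> bool -> {set 'I_m}) a i :
  (forall c : intervention m, acyclic (fun i => Phat i (c i))) ->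
  (forall c i, parents (post_mx B B' c) i \subset Phat i (c i)) ->
  admissible a i (Phat i (a i)).
Proof.
move=> Pdag nofn; split; first exact: nofn.
move=> c k ci kS; apply/negP => /connectP[p ip kE].
suff : i :: p = [::] by [].
apply: (Pdag c); rewrite /= rcons_path -kE ci kS andbT.
apply: sub_path ip => j l; exact: (fintype.subsetP (nofn c l)).
Qed.

End Model.

(** * Independence of one exogenous variable from everything else *)

Section NoiseSigma.
Context d (T : measurableType d) (R : realType) (P : probability T R).
Variables (m t : nat) (eps : 'I_t -> 'I_m -> {RV P >-> R}) (A : T -> policy m t).
Hypothesis hindep : independent_noise eps.
Hypothesis hA : forall c, measurable [set w | A w = c].
Hypothesis hAindep : independent_of_noise eps A.

Definition noise_event (C : {set policy m t}) (Q : 'I_t -> 'I_m -> set R) : set T :=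
  [set w | A w \in C /\ forall s j, Q s j (eps s j w)].

(* Generates the information carried by the interventions and by all the
   exogenous variables except that of node [i] at step [s0]. *)
Definition other_noise (s0 : 'I_t) (i : 'I_m) : set (set T) :=
  [set E | exists C Q, [/\ forall s j, measurable (Q s j), Q s0 i = setT &
     E = noise_event C Q]].

Let measurable_noise Q : (forall s j, measurable (Q s j)) ->
  measurable [set w | forall s j, Q s j (eps s j w)].
Proof.
move=> mQ.
rewrite (_ : [set w | _] = \bigcap_(s in [set: 'I_t]) \bigcap_(j in [set: 'I_m])
    (eps s j @^-1` Q s j)).
  apply: fin_bigcap_measurable => // s _; apply: fin_bigcap_measurable => // j _.
  by rewrite -[X in measurable X]setTI; exact: measurable_funP.
by apply/seteqP; split => w /= h => [s _ j _|s j]; exact: h.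
Qed.

Let measurable_policy (C : {set policy m t}) : measurable [set w | A w \in C].
Proof.
apply: (@measurable_finType _ _ _ A (fun c => [set w | c \in C])) => // c.
case: (c \in C); first by rewrite (_ : [set w | _] = setT)//; apply/seteqP.
by rewrite (_ : [set w | _] = set0)//; apply/seteqP; split => w.
Qed.

Lemma measurable_noise_event C Q : (forall s j, measurable (Q s j)) ->
  measurable (noise_event C Q).
Proof.
move=> mQ; rewrite (_ : noise_event C Q = [set w | A w \in C] `&`
  [set w | forall s j, Q s j (eps s j w)])//.
apply: measurableI; [exact: measurable_policy|exact: measurable_noise].
Qed.

Lemma noise_eventE C Q : (forall s j, measurable (Q s j)) ->
  (P (noise_event C Q) =
   P [set w | A w \in C] * P [set w | forall s j, Q s j (eps s j w)])%E.
Proof.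
move=> mQ; set Z := [set w | forall s j, _].
have mZ : measurable Z by exact: measurable_noise.
have fC : finite_set [set` C] by exact: finite_finset.
have U1 : noise_event C Q = \bigcup_(c in [set` C]) ([set w | A w = c] `&` Z).
  apply/seteqP; split => [w [AC Zw]|w [c /= cC [Awc Zw]]]; first by exists (A w).
  by split=> //; rewrite Awc.
have U2 : [set w | A w \in C] = \bigcup_(c in [set` C]) [set w | A w = c].
  apply/seteqP; split => [w AC|w [c /= cC Awc]]; first by exists (A w).
  by rewrite /= Awc.
rewrite U1 U2 !measure_fin_bigcup//.
- rewrite ge0_mule_fsuml//; apply: eq_fsbigr => c _.
  by rewrite -hAindep.
- by move=> c c' _ _ [w [/= <- <-]].
- by move=> c c' _ _ [w [[/= <- _] [<- _]]].
- by move=> c _; exact: measurableI.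
Qed.

Lemma other_noise_measurable s0 i : other_noise s0 i `<=` measurable.
Proof. by move=> _ [C [Q [mQ _ ->]]]; exact: measurable_noise_event. Qed.

Lemma other_noise_setI s0 i : setI_closed (other_noise s0 i).
Proof.
move=> _ _ [C [Q [mQ Q0 ->]]] [C' [Q' [mQ' Q0' ->]]].
exists (C :&: C')%SET, (fun s j => Q s j `&` Q' s j); split.
- by move=> s j; exact: measurableI.
- by rewrite Q0 Q0' setTI.
apply/seteqP; split => w; rewrite /noise_event /= inE.
  by move=> [[C1 H1] [C2 H2]]; split=> //; apply/andP.
by move=> [/andP[C1 C2] h]; split; split => // s j; have [] := h s j.
Qed.

Lemma other_noise_setT s0 i : other_noise s0 i setT.
Proof.
exists [set: policy m t]%SET, (fun _ _ => setT); split => //.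
by apply/seteqP; split => w //= _; split; rewrite ?inE.
Qed.

(** It suffices to treat the generators. These leave the slot [(s0, i)] unconstrained, so
    intersecting fills it with [Q0], and the product formula splits off exactly one factor. *)
Lemma other_noise_indep s0 i E (Q0 : set R) : <<s other_noise s0 i >> E ->
  measurable Q0 -> (P (E `&` eps s0 i @^-1` Q0) = P E * P (eps s0 i @^-1` Q0))%E.
Proof.
move=> HE mQ0; apply: (indep_g_sigma_algebra _ _ _ _ _ HE).
- exact: other_noise_measurable.
- exact: other_noise_setI.
- exact: other_noise_setT.
- by rewrite -[X in measurable X]setTI; exact: measurable_funP.
move=> _ [C [Q [mQ QT ->]]].
pose Q' s j := if (s, j) == (s0, i) then Q0 else Q s j.
have mQ' s j : measurable (Q' s j) by rewrite /Q'; case: ifP.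
have -> : noise_event C Q `&` eps s0 i @^-1` Q0 = noise_event C Q'.
  apply/seteqP; split => w.
    move=> [[AC H] H0]; split=> // s j; rewrite /Q'.
    by case: eqP => [[-> ->]|_].
  move=> [AC H]; split; last by have := H s0 i; rewrite /Q' eqxx.
  split=> // s j; have := H s j; rewrite /Q'.
  by case: eqP => [[-> ->] _|//]; rewrite QT.
rewrite !noise_eventE// -muleA; congr (_ * _)%E; rewrite !hindep//.
rewrite !pair_bigA/= (bigD1 (s0, i))//= [in RHS](bigD1 (s0, i))//=.
rewrite {1}/Q' eqxx QT.
have -> : P [set w | [set: R] (eps s0 i w)] = 1%E.
  by rewrite -(probability_setT P); congr (P _); apply/seteqP.
rewrite mul1e muleC; congr (_ * _)%E; apply: eq_bigr => -[s j] /= sj.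
by rewrite /Q' (negbTE sj).
Qed.

Lemma mfun_other_noise s0 i s j : (s, j) != (s0, i) ->
  (other_noise s0 i).-mfun (eps s j).
Proof.
move=> sj _ Q mQ; rewrite setTI; apply: sub_sigma_algebra.
exists [set: policy m t]%SET, (fun s' j' => if (s', j') == (s, j) then Q else setT).
split.
- by move=> s' j'; case: ifP.
- by rewrite eq_sym (negbTE sj).
apply/seteqP; split => w /=.
  by move=> Qw; split; [exact: finset.in_setT|move=> s' j'; case: eqP => [[-> ->]|]].
by move=> [_ /(_ s j)]; rewrite eqxx.
Qed.

Lemma policy_other_noise s0 i c : <<s other_noise s0 i >> [set w | A w = c].
Proof.
apply: sub_sigma_algebra; exists [set c]%SET, (fun _ _ => setT); split => //.
apply/seteqP; split => w; rewrite /noise_event/= finset.inE.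
  by move=> ->; rewrite eqxx.
by move=> [/eqP].
Qed.

End NoiseSigma.

(** * Conditional covariance and tail of the weight error for a fixed parent set *)

Section Identification.
Context d (T : measurableType d) (R : realType) (P : probability T R).
Variables (m t : nat) (B B' : 'M[R]_m) (nu : 'cV[R]_m) (sigma : 'I_m -> R).
Variables (eps : 'I_t -> 'I_m -> {RV P >-> R}) (A : T -> policy m t).
Variables (X : T -> 'M[R]_(m, t)) (a : intervention m).
Hypothesis hdag : forall c : intervention m, acyclic (parents (post_mx B B' c)).
Hypothesis hsigma : forall i, 0 < sigma i.
Hypothesis hgauss : forall s i (Q : set R), measurable Q ->
  distribution P (eps s i) Q = normal_prob (nu i 0) (sigma i) Q.
Hypothesis hindep : independent_noise eps.
Hypothesis hA : forall c, measurable [set w | A w = c].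
Hypothesis hAindep : independent_of_noise eps A.
Hypothesis hX : forall w s, col s (X w) =
  (post_mx B B' (A w s))^T *m col s (X w) + \col_i eps s i w.

Let W := sem_mx B B'.

Let XE w k s : X w k s = \sum_j W (A w s) j k * eps s j w.
Proof. by apply: (sem_solution hdag); exact: hX. Qed.

Lemma measurable_data : measurable_mx X.
Proof.
move=> k s; under eq_fun do rewrite XE.
apply: (@measurable_fun_finType _ _ _ _ A
  (fun c w => \sum_j W (c s) j k * eps s j w)) => // c.
by apply: measurable_sum => j; exact: measurable_funM.
Qed.

Variables (i : 'I_m) (S : {set 'I_m}).
Hypothesis hS : admissible B B' a i S.

Definition design_events : set (set T) :=
  [set E | (exists c, E = [set w | A w = c]) \/
     (exists k s (Q : set R), [/\ k \in S, measurable Q &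
        E = [set w | A w s i = a i /\ Q (X w k s)]])].

Lemma measurable_design : <<s design_events >> `<=` measurable.
Proof.
apply: smallest_sub; first exact: sigma_algebra_measurable.
move=> _ [[c ->]//|[k [s [Q [kS mQ ->]]]]].
pose F (c : policy m t) := [set w | c s i = a i] `&` [set w | Q (X w k s)].
apply: (@measurable_finType _ _ _ A F) => // c; apply: measurableI.
  case: (eqVneq (c s i) (a i)) => [ci|/eqP ci].
    by rewrite (_ : [set w | _] = setT)//; apply/seteqP; split => w.
  by rewrite (_ : [set w | _] = set0)//; apply/seteqP; split => w.
by rewrite -[X in measurable X]setTI; exact: measurable_data.
Qed.

(** Exogeneity enters here: with the interventions fixed, a regressor at a step where [i] has status
    [a i] is linear in the noise of that step, with coefficient 0 on node [i] because [S] contains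
    no descendant of [i]. *)
Lemma design_other_noise s0 :
  <<s design_events >> `<=` <<s other_noise eps A s0 i >>.
Proof.
apply: smallest_sub; first exact: smallest_sigma_algebra.
move=> _ [[c ->]|[k [s [Q [kS mQ ->]]]]]; first exact: policy_other_noise.
pose TH := g_sigma_algebraType (other_noise eps A s0 i).
pose F (c : policy m t) := if c s i == a i then
  [set w | Q (\sum_j W (c s) j k * eps s j w)] else set0.
have -> : [set w | A w s i = a i /\ Q (X w k s)] = [set w | F (A w) w].
  apply/seteqP; split => w; rewrite /F/= XE; first by move=> [-> ?]; rewrite eqxx.
  by case: eqP.
apply: (@measurable_finType _ TH _ A F) => [c|c]; first exact: policy_other_noise.
rewrite /F; case: eqP => [ci|_]; last exact: measurable0.
rewrite -[X in measurable X]setTI.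
suff : measurable_fun [set: TH] (fun w : TH => \sum_j W (c s) j k * eps s j w).
  by apply.
apply: measurable_sum => j.
have [sj|sj] := eqVneq (s, j) (s0, i); last first.
  by apply: measurable_funM => //; exact: mfun_other_noise.
have -> : j = i by case: sj.
rewrite (sem_mx_eq0 hdag hS ci kS); under eq_fun do rewrite mul0r.
exact: measurable_cst.
Qed.

Let TG := g_sigma_algebraType design_events.

Lemma measurable_design_mx :
  measurable_mx (fun w : TG => design (X w) (A w) i (a i) S).
Proof.
move=> p s _ Q mQ; rewrite setTI.
pose E Q := [set w | A w s i = a i /\ Q (X w (enum_val p) s)].
have mE Q' : measurable Q' -> measurable (E Q' : set TG).
  move=> mQ'; apply: sub_sigma_algebra; right; exists (enum_val p), s, Q'.
  by split=> //; exact: enum_valP.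
have mET := mE _ measurableT; have mEQ := mE _ mQ.
(* The generators see a regressor only at steps of the right status; elsewhere the entry of [design]
   is 0, so the preimage is all or nothing. *)
rewrite (_ : _ @^-1` Q = E Q `|` (~` E setT `&` [set w | Q 0])).
  apply: measurableU => //; apply: measurableI; first exact: measurableC.
  have [Q0|Q0] := pselect (Q 0).
    by rewrite (_ : [set w | _] = setT)//; apply/seteqP; split => w.
  by rewrite (_ : [set w | _] = set0)//; apply/seteqP; split => w.
apply/seteqP; split => w; rewrite /E /preimage /= mxE.
  case: eqP => ci Qw; first by left.
  by right; split=> // -[].
case: eqP => ci [[]|[]]//.
by move=> h; exfalso; apply: h.
Qed.

Let L w := noise_coef (X w) (A w) i (a i) S.
Let beta k := post_mx B B' a k i.
Let c w := bias (X w) (A w) i (a i) S beta.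

Let mD := measurable_design_mx.

Let mG : measurable_mx (fun w : TG => design (X w) (A w) i (a i) S *m
  (design (X w) (A w) i (a i) S)^T).
Proof. by apply: measurable_mx_mul => //; exact: measurable_mx_tr. Qed.

Lemma mfun_noise_coef k s : design_events.-mfun (fun w => L w k s).
Proof.
rewrite /L /noise_coef; under eq_fun do rewrite big_mkcond.
apply: measurable_sum => p; case: (enum_val p == k); last exact: measurable_cst.
by apply: (measurable_mx_mul _ mD); exact: measurable_mx_inv.
Qed.

Lemma mfun_bias k : design_events.-mfun (fun w => c w k).
Proof.
rewrite /c /bias; under eq_fun do rewrite big_mkcond.
apply: measurable_funB; last exact: measurable_cst.
apply: measurable_sum => p; case: (enum_val p == k); last exact: measurable_cst.
apply: measurable_mx_mul; last exact: measurable_mx_cst.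
by apply: measurable_mx_mul => //; exact: measurable_mx_inv.
Qed.

(** At a retained step node [i] has status [a i], so its column of the post-intervention matrix is
    that of [a], whatever the other nodes undergo: the steps share the coefficients [beta]. *)
Lemma weight_errorE w k : weight_error (X w) (A w) B B' nu a i S k 0 =
  c w k + \sum_s L w k s * (eps s i w - nu i 0).
Proof.
have -> : weight_error (X w) (A w) B B' nu a i S k 0 =
    mmse_col (X w) (A w) nu i (a i) S k 0 - beta k.
  by rewrite /weight_error ![in LHS]mxE [in RHS]mxE /beta mxE.
apply: (@mmse_error _ _ _ (X w) (A w) nu i (a i) S beta (fun s => eps s i w)).
  by move=> j bj; apply: (fintype.subsetP hS.1); rewrite inE.
move=> s As; have /matrixP/(_ i 0) := hX w s; rewrite !mxE => ->.
congr (_ + _); apply: eq_bigr => j _; rewrite !mxE.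
by rewrite /beta !mxE As.
Qed.

Let ind s E Q := @other_noise_indep _ _ _ _ _ _ _ _ hindep hA hAindep s i E Q.

Let HT s : <<s other_noise eps A s i >> `<=` measurable.
Proof.
apply: smallest_sub; first exact: sigma_algebra_measurable.
exact: other_noise_measurable.
Qed.

Let HX s s' : s' != s -> (other_noise eps A s i).-mfun (eps s' i).
Proof. by move=> ss'; apply: mfun_other_noise; rewrite xpair_eqE (negbTE ss'). Qed.

Let law s := @hgauss s i.

Lemma weight_cov (Phi : T -> 'M[R]_m) :
  cond_covariance P (design_sigma X A i (a i) S)
    (fun w => weight_error (X w) (A w) B B' nu a i S) Phi ->
  \forall w \ae P, forall k l,
    Phi w k l = normal_variance (nu i 0) (sigma i) * \sum_s L w k s * L w l s.
Proof.
move=> [_ [e [he hC]]].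
have me k : design_events.-mfun (fun w => e w k 0).
  by case: (he k) => h _ _ _ Q mQ; rewrite setTI; exact: h.
have em k := cond_mean (hsigma i) law design_other_noise HT measurable_design ind
  (mfun_noise_coef k) (mfun_bias k) (fun w => weight_errorE w k) (he k).
have cov k l := cond_cov (hsigma i) law design_other_noise HT measurable_design HX ind
  (mfun_noise_coef k) (mfun_noise_coef l) (mfun_bias k) (mfun_bias l) (fun w => weight_errorE w k)
  (fun w => weight_errorE w l) (me k) (me l) (em k) (em l) (hC k l).
by apply: filter_forall => k; apply: filter_forall => l; exact: cov.
Qed.

Lemma weight_tail (mu : 'cV[R]_m) (r : R) : 0 <= r ->
  (P [set w | 0 < \sum_s (\sum_k mu k 0 * L w k s) ^+ 2 /\
     r * sigma i * Num.sqrt (\sum_s (\sum_k mu k 0 * L w k s) ^+ 2) <=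
       `|\sum_s (\sum_k mu k 0 * L w k s) * (eps s i w - nu i 0)| ]%R
   <= (2 * expR (- (r ^+ 2 / 2)))%:E)%E.
Proof.
move=> r0.
apply: (gaussian_tail (hsigma i) law design_other_noise HT measurable_design HX ind) => // s.
apply: measurable_sum => k; apply: measurable_funM; first exact: measurable_cst.
exact: mfun_noise_coef.
Qed.

Lemma measurable_weight_tail (mu : 'cV[R]_m) (r : R) :
  measurable [set w | 0 < \sum_s (\sum_k mu k 0 * L w k s) ^+ 2 /\
     r * sigma i * Num.sqrt (\sum_s (\sum_k mu k 0 * L w k s) ^+ 2) <=
       `|\sum_s (\sum_k mu k 0 * L w k s) * (eps s i w - nu i 0)| ].
Proof.
have ml s : measurable_fun setT (fun w => \sum_k mu k 0 * L w k s).
  apply: measurable_sum => k; apply: measurable_funM => //.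
  by move=> ? Q mQ; apply: measurable_design; exact: mfun_noise_coef.
have mq : measurable_fun setT (fun w => \sum_s (\sum_k mu k 0 * L w k s) ^+ 2).
  by apply: measurable_sum => s; exact: measurable_funX.
apply: measurableI; rewrite -[X in measurable X]setTI.
  by apply: measurable_fun_ltr.
apply: measurable_fun_ler => //.
  by apply: measurable_funM => //; exact: measurable_sqrt.
apply: measurableT_comp => //; apply: measurable_sum => s.
by apply: measurable_funM => //; exact: measurable_funB.
Qed.

End Identification.

(** * From the error of the mean to one weight error *)

Section Deterministic.
Variables (R : realType) (n : nat).
Implicit Types (M Bhat : 'M[R]_n.+1) (nu mu : 'cV[R]_n.+1).

Definition log_factor (delta : R) : R := ln (2 * n.+1%:R / delta).

(* The squared number of standard deviations allowed by the error bound. *)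
Definition deviation2 (delta : R) : R :=
  4 * Num.sqrt (n.+1%:R ^+ 2 + 2 * n.+1%:R) * log_factor delta.

Lemma log_factor_gt0 delta : 0 < delta < 1 -> 0 < log_factor delta.
Proof.
move=> /andP[d0 d1]; rewrite ln_gt0// ltr_pdivlMr// mul1r.
rewrite (lt_le_trans d1)// -natrM -[leLHS]/(1%:R) ler_nat.
by rewrite muln_gt0.
Qed.

Lemma deviation2_ge0 delta : 0 < delta < 1 -> 0 <= deviation2 delta.
Proof.
by move=> /log_factor_gt0/ltW h; rewrite !mulr_ge0// sqrtr_ge0.
Qed.

Lemma error_bound_sqr Bhat mu (Phi : 'I_n.+1 -> 'M[R]_n.+1) delta :
  0 < delta < 1 -> (forall i, 0 <= lambda_max (Phi i)) ->
  0 <= error_bound Bhat mu Phi delta /\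
  error_bound Bhat mu Phi delta ^+ 2 =
    (\sum_k col ord_max (invmx (1%:M - Bhat)) k 0 ^+ 2) *
    (deviation2 delta * (\sum_k mu k 0 ^+ 2) * \sum_i lambda_max (Phi i)).
Proof.
move=> /log_factor_gt0/ltW L0 l0; have S0 : 0 <= \sum_i lambda_max (Phi i) by exact: sumr_ge0.
have K0 : 0 <= n.+1%:R ^+ 2 + 2 * n.+1%:R :> R by rewrite addr_ge0 ?sqr_ge0// mulr_ge0.
split.
  by rewrite /error_bound !mulr_ge0 ?sqrtr_ge0 ?powR_ge0.
rewrite /error_bound !exprMn !norm2_sqr sqr_sqrtr ?mulr_ge0//.
have -> : ((n.+1%:R ^+ 2 + 2 * n.+1%:R) `^ 4^-1) ^+ 2 =
    Num.sqrt (n.+1%:R ^+ 2 + 2 * n.+1%:R) :> R.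
  rewrite -powR12_sqrt// -powR_mulrn ?powR_ge0// -powRrM; congr (_ `^ _).
  by field.
rewrite /deviation2 /log_factor; ring.
Qed.

Lemma tail_sum_le delta : 0 < delta < 1 ->
  (n.+1 * 2 ^ n.+1)%:R * (2 * expR (- (deviation2 delta / 2))) <= delta.
Proof.
move=> d01; have /andP[d0 d1] := d01; have L0 := log_factor_gt0 d01.
set N : R := n.+1%:R; have N1 : 1 <= N by rewrite ler1n.
have N0 : 0 < N by rewrite ltr0n.
pose q := delta / (2 * N).
have q0 : 0 < q by rewrite divr_gt0// mulr_gt0.
have q12 : q <= 2^-1.
  rewrite ler_pdivrMr ?mulr_gt0// mulrA mulVf ?pnatr_eq0// mul1r.
  exact: le_trans (ltW d1) N1.
have eL : expR (- log_factor delta) = q.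
  rewrite expRN lnK; last by rewrite posrE divr_gt0// mulr_gt0.
  by rewrite invf_div.
have h1 : expR (- (deviation2 delta / 2)) <= q ^+ n.+1 * q ^+ n.+1.
  rewrite -exprD -eL -expRM_natl ler_expR natrD -/N /deviation2 mulrN lerN2.
  have : N <= Num.sqrt (N ^+ 2 + 2 * N).
    rewrite -[leLHS](@ger0_norm _ N) ?(ltW N0)// -sqrtr_sqr ler_wsqrtr// lerDl.
    by rewrite mulr_ge0// ltW.
  set s := Num.sqrt _ => Ns; have := ler_wpM2r (ltW L0) Ns; lra.
(* Half of the exponent [2N] pays for the [2^N] parent sets, as [2 * q <= 1]; the other half leaves
   at most [q], and [delta = 2 * N * q]. *)
have h2 : 2 ^+ n.+1 * q ^+ n.+1 <= 1.
  rewrite -exprMn exprn_ile1//; first by rewrite mulr_ge0// ltW.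
  by rewrite -ler_pdivlMl// mulr1.
have h3 : q ^+ n.+1 <= q.
  rewrite exprS ler_piMr ?(ltW q0)// exprn_ile1 ?(ltW q0)//.
  by apply: le_trans q12 _; rewrite invf_le1// ler1n.
have -> : (n.+1 * 2 ^ n.+1)%:R = N * 2 ^+ n.+1 :> R by rewrite natrM natrX.
have q2 : delta = 2 * N * q by rewrite /q; field; rewrite gt_eqF.
rewrite [leRHS]q2.
apply: (@le_trans _ _ (N * 2 ^+ n.+1 * (2 * (q ^+ n.+1 * q ^+ n.+1)))).
  by rewrite ler_pM2l ?mulr_gt0 ?exprn_gt0// ler_pM2l.
have -> : N * 2 ^+ n.+1 * (2 * (q ^+ n.+1 * q ^+ n.+1)) =
   2 * N * ((2 ^+ n.+1 * q ^+ n.+1) * q ^+ n.+1) by ring.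
rewrite ler_pM2l ?mulr_gt0//; apply: le_trans h3.
by rewrite ler_piMl// exprn_ge0// ltW.
Qed.

(** [Q i] stands for the conditional variance of [e i]. If no index were as claimed, Cauchy-Schwarz
    would put the error of the mean strictly below the bound. *)
Lemma large_weight_error M Bhat nu (Phi : 'I_n.+1 -> 'M[R]_n.+1) delta
    (Q : 'I_n.+1 -> R) (h : 'I_n.+1 -> nat) :
  let mu := mean_mx M nu in
  let e i := \sum_k mu k 0 * (Bhat - M) k i in
  0 < delta < 1 -> nu != 0 -> 1%:M - M \in unitmx ->
  (forall k i, Bhat k i != 0 -> (h k < h i)%N) ->
  (forall i, 0 <= lambda_max (Phi i)) -> (exists i, 0 < lambda_max (Phi i)) ->
  (forall i, Q i <= lambda_max (Phi i) * \sum_k mu k 0 ^+ 2) ->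
  (forall i, 0 <= Q i) -> (forall i, Q i = 0 -> e i = 0) ->
  error_bound Bhat mu Phi delta <= `|(mean_mx Bhat nu - mu) ord_max 0| ->
  exists i, 0 < Q i /\ deviation2 delta * Q i <= e i ^+ 2.
Proof.
move=> mu e d01 nu0 uM hB l0 [i0 li0] Ql Q0 Qe0 Ue.
have uB := one_sub_unitmx hB.
have [U0 U2] := error_bound_sqr Bhat mu d01 l0.
have kap := deviation2_ge0 d01.
have kap0 : 0 < deviation2 delta.
  apply: mulr_gt0; last exact: log_factor_gt0.
  apply: mulr_gt0 => //; rewrite sqrtr_gt0.
have mu0 : mu != 0.
  apply: contra nu0 => /eqP m0; have : (1%:M - M)^T *m mu = nu.
    by rewrite /mu /mean_mx mulmxA -trmx_mul mulVmx// trmx1 mul1mx.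
  by rewrite m0 mulmx0 => ->.
have smu : 0 < \sum_k mu k 0 ^+ 2.
  by rewrite -norm2_sqr exprn_gt0// norm2_gt0.
set C := \sum_k col ord_max (invmx (1%:M - Bhat)) k 0 ^+ 2.
have C0 : 0 < C.
  rewrite /C -norm2_sqr exprn_gt0// norm2_gt0//; apply/eqP => c0.
  have : (1%:M - Bhat) *m col ord_max (invmx (1%:M - Bhat)) = delta_mx ord_max 0.
    by rewrite colE mulmxA mulmxV// mul1mx.
  rewrite c0 mulmx0 => /matrixP/(_ ord_max 0); rewrite !mxE eqxx => /esym/eqP.
  by rewrite oner_eq0.
have DE : (mean_mx Bhat nu - mu) ord_max 0 =
    \sum_i col ord_max (invmx (1%:M - Bhat)) i 0 * e i.
  rewrite mean_mx_sub// mxE; apply: eq_bigr => i _; rewrite !mxE; congr (_ * _).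
  by apply: eq_bigr => k _; rewrite !mxE mulrC.
apply: contrapT => /forallNP noQ.
set s := \sum_k mu k 0 ^+ 2 in smu Ql U2 *.
have ks : 0 < deviation2 delta * s by exact: mulr_gt0.
have elt i : 0 < Q i -> e i ^+ 2 < deviation2 delta * s * lambda_max (Phi i).
  move=> Qi; have /not_andP[//|/negP] := noQ i; rewrite -ltNge => h1.
  apply: lt_le_trans h1 _; rewrite -mulrA ler_pM2l//.
  by rewrite mulrC.
have ele i : e i ^+ 2 <= deviation2 delta * s * lambda_max (Phi i).
  have := Q0 i; rewrite le_eqVlt => /orP[/eqP Qi|/elt/ltW//].
  by rewrite Qe0// expr0n/= pmulr_rge0.
(* One strict term makes the whole sum strict; the positive eigenvalue gives it even if
   [Q i0 = 0]. *)
have elt0 : e i0 ^+ 2 < deviation2 delta * s * lambda_max (Phi i0).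
  have := Q0 i0; rewrite le_eqVlt => /orP[/eqP Qi|/elt//].
  by rewrite Qe0// expr0n/= pmulr_rgt0.
have : `|(mean_mx Bhat nu - mu) ord_max 0| ^+ 2 <= C * \sum_i e i ^+ 2.
  by rewrite DE real_normK ?num_real//; exact: cauchy_schwarz_sum.
rewrite leNgt => /negP; apply.
apply: (@lt_le_trans _ _ (error_bound Bhat mu Phi delta ^+ 2)).
  rewrite U2 -/C ltr_pM2l// mulr_sumr (bigD1 i0)//= [ltRHS](bigD1 i0)//=.
  by apply: ltr_leD => //; apply: ler_sum.
by rewrite ler_sqr ?nnegrE.
Qed.

End Deterministic.

(** * Measurability of the error event and auxiliary estimates *)

Section EventMeasurability.
Context d (T : measurableType d) (R : realType).
Variables (m t : nat) (nu : 'cV[R]_m) (A : T -> policy m t) (X : T -> 'M[R]_(m, t)).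
Hypothesis hA : forall c, measurable [set w | A w = c].
Hypothesis mX : measurable_mx X.

Lemma measurable_mmse_col i b S :
  measurable_mx (fun w => mmse_col (X w) (A w) nu i b S).
Proof.
move=> k j; rewrite ord1.
apply: (@measurable_fun_finType _ _ _ _ A
  (fun c w => mmse_col (X w) c nu i b S k 0)) => // c.
under eq_fun do rewrite mxE big_mkcond.
apply: measurable_sum => p; case: (enum_val p == k); last exact: measurable_cst.
have mreg : measurable_mx (fun w => regressors (X w) c i b S).
  by move=> p' q; under eq_fun do rewrite mxE; exact: mX.
have mresp : measurable_mx (fun w => (response (X w) c i b - const_mx (nu i 0))^T).
  apply: measurable_mx_tr; apply: measurable_mx_sub; last exact: measurable_mx_cst.
  by move=> p' q; under eq_fun do rewrite mxE; exact: mX.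
have mgram : measurable_mx (fun w => gram (X w) c i b S).
  by apply: measurable_mx_mul => //; exact: measurable_mx_tr.
suff : measurable_mx (fun w => mmse_coef (X w) c nu i b S) by apply.
apply: measurable_mx_mul => //; apply: measurable_mx_mul => //.
exact: measurable_mx_inv.
Qed.

Lemma measurable_mmse_mx Phat (a : intervention m) :
  (forall i b S, measurable [set w | Phat (X w) (A w) i b = S]) ->
  measurable_mx (fun w => mmse_mx (X w) (A w) nu (Phat (X w) (A w)) a).
Proof.
move=> hPhat k i; under eq_fun do rewrite mxE.
apply: (@measurable_fun_finType _ _ _ _ (fun w => Phat (X w) (A w) i (a i))
  (fun S w => mmse_col (X w) (A w) nu i (a i) S k 0)) => [S|S]; first exact: hPhat.
exact: measurable_mmse_col.
Qed.

Lemma measurable_mean_mx (M : T -> 'M[R]_m) : measurable_mx M ->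
  measurable_mx (fun w => mean_mx (M w) nu).
Proof.
move=> mM; apply: measurable_mx_mul; last exact: measurable_mx_cst.
apply: measurable_mx_tr; apply: measurable_mx_inv.
by apply: measurable_mx_sub => //; exact: measurable_mx_cst.
Qed.

End EventMeasurability.

Lemma measurable_error_bound d (T : measurableType d) (R : realType) (n : nat)
    (Bhat : T -> 'M[R]_n.+1) (mu : 'cV[R]_n.+1) (lam : 'I_n.+1 -> T -> 'M[R]_n.+1)
    (delta : R) :
  measurable_mx Bhat -> (forall i, measurable_fun setT (fun w => lambda_max (lam i w))) ->
  measurable_fun setT (fun w => error_bound (Bhat w) mu (fun i => lam i w) delta).
Proof.
move=> mB ml; rewrite /error_bound; apply: measurable_funM.
  apply: measurable_funM; last exact: measurable_cst.
  apply: measurable_funM; first exact: measurable_cst.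
  apply: measurable_norm2 => k j; under eq_fun do rewrite mxE.
  apply: (@measurable_mx_inv _ _ _ _ (fun w => 1%:M - Bhat w)).
  by apply: measurable_mx_sub => //; exact: measurable_mx_cst.
apply: measurable_sqrt; apply: measurable_funM; first exact: measurable_cst.
exact: measurable_sum.
Qed.

Lemma measure_bigsetU_le d (T : measurableType d) (R : realType)
    (P : probability T R) (I : Type) (r : seq I) (F : I -> set T) :
  (forall x, measurable (F x)) ->
  (P (\big[setU/set0]_(x <- r) F x) <= \sum_(x <- r) P (F x))%E.
Proof.
move=> mF; elim: r => [|x r IH]; first by rewrite !big_nil measure0.
rewrite !big_cons; apply: le_trans (measureU2 _ _ _) _ => //.
  by apply: bigsetU_measurable => y _.
exact: leeD.
Qed.

Lemma le_measure_ae d (T : measurableType d) (R : realType) (P : probability T R)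
    (E F : set T) : measurable E -> measurable F ->
  (\forall w \ae P, E w -> F w) -> (P E <= P F)%E.
Proof.
move=> mE mF EF; have mD := measurableD mE mF.
have D0 : P (E `\` F) = 0%E.
  apply/negligibleP => //; apply: negligibleS EF => w [Ew Fw] /= h.
  exact/Fw/h.
apply: (@le_trans _ _ (P (F `|` (E `\` F)))).
  apply: le_measure; rewrite ?inE//; first exact: measurableU.
  by move=> w Ew; have [Fw|Fw] := pselect (F w); [left|right].
apply: (@le_trans _ _ (P F + P (E `\` F))%E); first exact: measureU2.
by rewrite D0 adde0.
Qed.

Lemma sum_gram_quadratic (R : comNzRingType) (I J : finType) (c : R) (v : I -> R)
    (L : I -> J -> R) :
  \sum_k \sum_j v k * (c * \sum_s L k s * L j s) * v j =
  c * \sum_s (\sum_k v k * L k s) ^+ 2.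
Proof.
transitivity (\sum_k \sum_j \sum_s c * ((v k * L k s) * (v j * L j s))).
  apply: eq_bigr => k _; apply: eq_bigr => j _.
  by rewrite mulr_sumr mulr_sumr mulr_suml; apply: eq_bigr => s _; ring.
under eq_bigr do rewrite exchange_big/=.
rewrite exchange_big/= mulr_sumr; apply: eq_bigr => s _.
rewrite expr2 mulr_suml mulr_sumr; apply: eq_bigr => k _.
by rewrite mulr_sumr mulr_sumr.
Qed.

Theorem theorem1 (R : realType) (d : measure_display) (T : measurableType d)
    (P : probability T R) (n t : nat)
    (* structural equation model on n.+1 nodes *)
    (B B' : 'M[R]_n.+1) (nu : 'cV[R]_n.+1) (sigma : 'I_n.+1 -> R)
    (eps : 'I_t -> 'I_n.+1 -> {RV P >-> R})
    (A : T -> policy n.+1 t) (X : T -> 'M[R]_(n.+1, t))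
    (* estimated parent sets, as a function of the data *)
    (Phat : 'M[R]_(n.+1, t) -> policy n.+1 t ->
            'I_n.+1 -> bool -> {set 'I_n.+1})
    (a : intervention n.+1)
    (Phi : 'I_n.+1 -> {set 'I_n.+1} -> T -> 'M[R]_n.+1)
    (delta : R)
    (hdag : forall c : intervention n.+1, acyclic (parents (post_mx B B' c)))
    (hsigma : forall i, 0 < sigma i)
    (hgauss : forall s i (Q : set R), measurable Q ->
       distribution P (eps s i) Q = normal_prob (nu i 0) (sigma i) Q)
    (hindep : independent_noise eps)
    (hA : forall c, measurable [set w | A w = c])
    (hAindep : independent_of_noise eps A)
    (hX : forall w s,
       col s (X w) = (post_mx B B' (A w s))^T *m col s (X w)
                     + \col_i eps s i w)
    (hPhat : forall i b S, measurable [set w | Phat (X w) (A w) i b = S])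
    (hPhat_dag : \forall w \ae P, forall c : intervention n.+1,
       acyclic (fun i => Phat (X w) (A w) i (c i)))
    (* no false negatives, for either status of each node *)
    (hnofn : \forall w \ae P, forall c i,
       parents (post_mx B B' c) i \subset Phat (X w) (A w) i (c i))
    (* the least-squares formula is well defined *)
    (hgram : \forall w \ae P, forall i,
       gram (X w) (A w) i (a i) (Phat (X w) (A w) i (a i)) \in unitmx)
    (hPhi : forall i S,
       cond_covariance P (design_sigma X A i (a i) S)
         (fun w => weight_error (X w) (A w) B B' nu a i S) (Phi i S))
    (* the bound does not degenerate to 0 *)
    (hnu : nu != 0)
    (hedge : \forall w \ae P,
       exists i, Phat (X w) (A w) i (a i) != finset.set0)
    (hdelta : 0 < delta) :
  let mu := mean_mx (post_mx B B' a) nu in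
  let Bhat w := mmse_mx (X w) (A w) nu (Phat (X w) (A w)) a in
  let Dmu w := mean_mx (Bhat w) nu - mu in
  let U w := error_bound (Bhat w) mu
               (fun i => Phi i (Phat (X w) (A w) i (a i)) w) delta in
  (P [set w | (U w <= `|Dmu w ord_max 0|)%R] <= delta%:E)%E.
Proof.
pose mu := mean_mx (post_mx B B' a) nu.
pose Bhat w := mmse_mx (X w) (A w) nu (Phat (X w) (A w)) a.
pose Dmu w := mean_mx (Bhat w) nu - mu.
pose U w := error_bound (Bhat w) mu
  (fun i => Phi i (Phat (X w) (A w) i (a i)) w) delta.
change (P [set w | (U w <= `|Dmu w ord_max 0|)%R] <= delta%:E)%E.
pose M := post_mx B B' a; pose Pw w := Phat (X w) (A w).
have uM : 1%:M - M \in unitmx by exact: post_unitmx.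
have mX := measurable_data hdag hA hX.
have mPhi i S : measurable_mx (Phi i S).
  move=> k l _ Q mQ; rewrite setTI; apply: (measurable_design hdag hA hX (a := a) (i := i) (S := S)).
  by have [_ [e [_ /(_ k l)[h _ _]]]] := hPhi i S; exact: h.
have mlam i : measurable_fun setT (fun w => lambda_max (Phi i (Pw w i (a i)) w)).
  apply: (@measurable_fun_finType _ _ _ _ (fun w => Pw w i (a i))
    (fun S w => lambda_max (Phi i S w))) => [S|S]; first exact: hPhat.
  by apply: measurable_lambda_max => // w; have [h _] := hPhi i S; exact: h.
have mBhat : measurable_mx Bhat by exact: measurable_mmse_mx.
have mE : measurable [set w | U w <= `|Dmu w ord_max 0| ].
  rewrite -[X in measurable X]setTI; apply: measurable_fun_ler => //.
    exact: (@measurable_error_bound _ _ _ n Bhat mu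
      (fun i w => Phi i (Pw w i (a i)) w) delta mBhat mlam).
  apply: measurableT_comp => //.
  have : measurable_mx Dmu.
    by apply: measurable_mx_sub; [exact: measurable_mean_mx|exact: measurable_mx_cst].
  by apply.
have [d1|d1] := leP 1 delta.
  by apply: (@le_trans _ _ 1%E); [exact: probability_le1|rewrite lee_fin].
have d01 : 0 < delta < 1 by rewrite hdelta.
pose r := Num.sqrt (deviation2 n delta).
pose L i S w := noise_coef (X w) (A w) i (a i) S.
pose l i S w s := \sum_k mu k 0 * L i S w k s.
(* Pairs that are not admissible get the empty set, so that one tail bound serves the whole finite
   type of pairs. Positivity of the sum excludes outcomes where both sides of the comparison are
   0. *)
pose bad (iS : 'I_n.+1 * {set 'I_n.+1}) := if `[< admissible B B' a iS.1 iS.2 >] then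
  [set w | 0 < \sum_s l iS.1 iS.2 w s ^+ 2 /\
   r * sigma iS.1 * Num.sqrt (\sum_s l iS.1 iS.2 w s ^+ 2) <=
     `|\sum_s l iS.1 iS.2 w s * (eps s iS.1 w - nu iS.1 0)| ] else set0.
have mbad iS : measurable (bad iS).
  rewrite /bad; case: asboolP => hS; last exact: measurable0.
  exact: measurable_weight_tail.
have Pbad iS : (P (bad iS) <= (2 * expR (- (deviation2 n delta / 2)))%:E)%E.
  rewrite /bad; case: asboolP => hS; last first.
    by rewrite measure0 lee_fin mulr_ge0// expR_ge0.
  have r2 : deviation2 n delta = r ^+ 2 by rewrite sqr_sqrtr// deviation2_ge0.
  by rewrite r2; apply: weight_tail => //; exact: sqrtr_ge0.
suff ae_bad : \forall w \ae P, U w <= `|Dmu w ord_max 0| ->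
    (\big[setU/set0]_(iS : 'I_n.+1 * {set 'I_n.+1}) bad iS) w.
  apply: le_trans (le_measure_ae mE _ ae_bad) _.
    by apply: bigsetU_measurable => iS _.
  apply: le_trans (measure_bigsetU_le _ _ mbad) _.
  apply: (@le_trans _ _ (\sum_(iS : 'I_n.+1 * {set 'I_n.+1})
    (2 * expR (- (deviation2 n delta / 2)))%:E)%E); first exact: lee_sum.
  have cS : #|{: {set 'I_n.+1}}| = (2 ^ n.+1)%N.
    by rewrite -cardsT -powersetT card_powerset cardsT card_ord.
  rewrite sumEFin lee_fin sumr_const card_prod card_ord cS.
  rewrite -[leLHS]mulr_natl; exact: tail_sum_le.
(* The null set is chosen uniformly over all fixed [S], so the formula may afterwards be read at the
   declared set, which depends on [w]. *)
have cov : \forall w \ae P, forall i S, admissible B B' a i S -> forall k j,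
    Phi i S w k j = normal_variance (nu i 0) (sigma i) * \sum_s L i S w k s * L i S w j s.
  apply: filter_forall => i; apply: filter_forall => S.
  have [hS|hS] := pselect (admissible B B' a i S); last exact: aeW.
  have := weight_cov hdag hsigma hgauss hindep hA hAindep hX hS (hPhi i S).
  by apply: filterS => w h _.
apply: filterS2 (filterI hPhat_dag hnofn) (filterI (filterI hgram hedge) cov).
move=> w [Pdag nofn] [[ugram edge] covw] Uw.
pose S i := Pw w i (a i).
have hS i : admissible B B' a i (S i) by exact: admissible_Phat.
have [h hh] := acyclic_rank (Pdag a).
have hB k i : Bhat w k i != 0 -> (h k < h i)%N.
  move=> Bki; apply: hh; apply: contraNT Bki => kS.
  rewrite /Bhat !mxE big_pred0// => p; apply/negbTE; apply: contra kS => /eqP <-.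
  exact: enum_valP.
pose Q i := normal_variance (nu i 0) (sigma i) * \sum_s l i (S i) w s ^+ 2.
have cv0 i : 0 < normal_variance (nu i 0) (sigma i).
  by apply: lt_le_trans (normal_variance_ge _ _); rewrite ?exprn_gt0// gt_eqF.
have eE i : \sum_k mu k 0 * (Bhat w - M) k i =
    \sum_s l i (S i) w s * (eps s i w - nu i 0).
  have wE k : (Bhat w - M) k i = \sum_s L i (S i) w k s * (eps s i w - nu i 0).
    have := weight_errorE nu hX (hS i) w k; rewrite bias_eq0; first last.
    - exact: ugram.
    - by move=> j bj; apply: (fintype.subsetP (hS i).1); rewrite inE.
    by rewrite add0r => <-; rewrite /weight_error !mxE.
  under eq_bigr do rewrite wE mulr_sumr.
  rewrite exchange_big/=; apply: eq_bigr => s _; rewrite /l mulr_suml.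
  by apply: eq_bigr => k _; rewrite mulrA.
have qE i (v : 'rV[R]_n.+1) : qform (Phi i (S i) w) v =
    normal_variance (nu i 0) (sigma i) * \sum_s (\sum_k v 0 k * L i (S i) w k s) ^+ 2.
  rewrite /qform; under eq_bigr do under eq_bigr do rewrite covw//.
  exact: sum_gram_quadratic.
have symPhi i : (Phi i (S i) w)^T = Phi i (S i) w.
  by have [sym _] := hPhi i (S i); exact: sym.
have Ql i : Q i <= lambda_max (Phi i (S i) w) * \sum_k mu k 0 ^+ 2.
  have [_ [_ [_ /(_ mu^T)]]] := lambda_max_rayleigh (symPhi i).
  rewrite qE; under [X in lambda_max _ * X]eq_bigr do rewrite mxE.
  by apply: le_trans; rewrite /Q /l; under [X in _ <= _ * X]eq_bigr do
    under eq_bigr do rewrite mxE.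
(* The Rayleigh bound at a basis vector: a diagonal entry of [Phi] is at most its largest
   eigenvalue. *)
have lpos i (k : 'I_n.+1) : normal_variance (nu i 0) (sigma i) * \sum_s L i (S i) w k s ^+ 2
    <= lambda_max (Phi i (S i) w).
  have [_ [_ [_ /(_ (delta_mx 0 k))]]] := lambda_max_rayleigh (symPhi i).
  have -> : \sum_j (delta_mx 0 k : 'rV[R]_n.+1) 0 j ^+ 2 = 1.
    rewrite (bigD1 k)//= mxE !eqxx expr1n big1 ?addr0// => j jk.
    by rewrite mxE eqxx (negbTE jk) expr0n.
  rewrite qE mulr1; apply: le_trans; rewrite ler_pM2l//; apply: ler_sum => s _.
  rewrite (_ : \sum_j _ = L i (S i) w k s)// (bigD1 k)//= mxE !eqxx mul1r.
  rewrite [X in _ + X]big1 ?addr0// => j jk.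
  by rewrite mxE eqxx (negbTE jk) mul0r.
have [] := @large_weight_error R n M (Bhat w) nu (fun i => Phi i (S i) w) delta Q h
  d01 hnu uM hB _ _ Ql _ _ Uw.
- move=> i; apply: le_trans (lpos i ord0).
  by rewrite mulr_ge0 ?(ltW (cv0 i))// sumr_ge0// => s _; exact: sqr_ge0.
(* A declared parent has a nonzero row of noise coefficients, hence a positive diagonal entry in
   [Phi]. *)
- have [i /set0Pn[k kS]] := edge; exists i; apply: lt_le_trans (lpos i k).
  rewrite mulr_gt0//; have [s Ls] := noise_coef_neq0 (ugram i) kS.
  rewrite (bigD1 s)//= ltr_pwDl// ?sumr_ge0// => [|s' _]; last exact: sqr_ge0.
  by rewrite exprn_even_gt0.
- by move=> i; rewrite mulr_ge0 ?(ltW (cv0 i))// sumr_ge0// => s _; exact: sqr_ge0.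
- move=> i /eqP; rewrite mulf_eq0 gt_eqF//= psumr_eq0 => [/allP l0|s _]; last exact: sqr_ge0.
  rewrite eE big1// => s _; have := l0 s (mem_index_enum _).
  by rewrite sqrf_eq0 => /eqP ->; rewrite mul0r.
move=> i [Qi]; rewrite eE => Qe.
rewrite (bigD1 (i, S i))//=; left; rewrite /bad/=; case: asboolP => // _.
have sl : 0 < \sum_s l i (S i) w s ^+ 2 by move: Qi; rewrite /Q pmulr_rgt0.
split=> //; rewrite -ler_sqr ?nnegrE ?normr_ge0//; last first.
  by rewrite !mulr_ge0 ?sqrtr_ge0// ltW.
rewrite real_normK ?num_real// !exprMn !sqr_sqrtr ?(ltW sl) ?deviation2_ge0//.
apply: le_trans Qe; rewrite /Q -mulrA ler_wpM2l ?deviation2_ge0//.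
(* The tail event is scaled by [sigma i ^+ 2] and [Q i] by the variance integral, which is at least
   as large. *)
by rewrite ler_pM2r// normal_variance_ge// gt_eqF.
Qed.
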